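(* Let $\gamma=\gamma_0/h$ with $\gamma_0>C_I$, so that $C=1-C_I/\gamma_0>0$. Then, for every $s>0$, $$c_PC\,\|v_1-v_2\|^2_{H^1(\Omega)}\le A_{h,s}(v_1,v_1-v_2)-A_{h,s}(v_2,v_1-v_2)\qquad\forall v_1,v_2\in V_h,$$ and the discrete problem: find $u_h\in V_h$ such that $A_{h,s}(u_h,v)=l(v)$ for all $v\in V_h$, has a unique solution for every $s>0$.
   Context: $\Omega\subset\mathbb R^d$, $d\in\{2,3\}$, is a bounded polygonal or polyhedral Lipschitz domain whose boundary is decomposed into relatively open, disjoint parts $\Gamma_D,\Gamma_C$ with $|\Gamma_D|>0$ and $\overline\Gamma_D\cup\overline\Gamma_C=\partial\Omega$. $(\cdot,\cdot)_D$ and $\|\cdot\|_D$ denote the $L^2(D)$ inner product and norm. $V=\{v\in H^1(\Omega): v=0\text{ on }\Gamma_D\}$, $a(v,w)=(\nabla v,\nabla w)_\Omega$, $l(w)=(f,w)_\Omega$ with $f\in L^2(\Omega)$, and $c_P>0$ is such that $c_P\|w\|_{H^1(\Omega)}^2\le a(w,w)$ for all $w\in V$. The obstacle is $g\in H^{1/2}(\Gamma_C)$. $\mathcal T_h$ is a shape-regular, quasiuniform, boundary-fitted partition of $\Omega$ with mesh parameter $h\in(0,h_0]$, and $V_h\subset V\cap C^0(\overline\Omega)$ is the conforming finite element space of continuous piecewise polynomials of degree $k$. For $v\in V_h$, $\sigma_n(v)=\nabla v\cdot\mathbf n$ is taken on each contact face from its unique adjacent element. $C_I$ is the constant (independent of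 $h$) in the trace inverse inequality $\|\sigma_n(w)\|^2_{\Gamma_C}\le C_Ih^{-1}\|\nabla w\|^2_\Omega$ for all $w\in V_h$. With $\gamma=\gamma_0/h$, set $P(v)=(v-g)-\sigma_n(v)/\gamma$, $DP(w)=w-\sigma_n(w)/\gamma$, $\varphi_{+,s}(t)=t/2+\sqrt{t^2/4+s}$, and $$A_{h,s}(v,w)=a(v,w)-\gamma^{-1}(\sigma_n(v),\sigma_n(w))_{\Gamma_C}+\gamma(\varphi_{+,s}(P(v)),DP(w))_{\Gamma_C}.$$ *)

(* Defs.v *)
From HB Require Import structures.
From mathcomp Require Import all_boot all_order all_algebra.
From mathcomp Require Import all_classical all_reals all_analysis.
From mathcomp Require Import measurable_realfun.
From mathcomp Require mpoly.

(* The notations of mpoly are incompatible with those of the analysis library. *)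
Import (canonicals, coercions) mpoly.

Set Implicit Arguments.
Unset Strict Implicit.
Unset Printing Implicit Defensive.

Import Order.TTheory GRing.Theory Num.Theory.
Import numFieldNormedType.Exports.

Local Open Scope classical_set_scope.
Local Open Scope ring_scope.

(* R^n carries the sigma-algebra generated by the coordinates, i.e. the Borel
   sigma-algebra, as the library does for tuples. *)
Section row_measurable.
Context {R : realType} (n : nat).

Let coor : 'I_n -> 'rV[R]_n -> measurableTypeR R := fun i x => x 0 i.

Let row_set0 : g_sigma_preimage coor set0.
Proof. exact: sigma_algebra0. Qed.

Let row_setC A : g_sigma_preimage coor A -> g_sigma_preimage coor (~` A).
Proof. exact: sigma_algebraC. Qed.

Let row_bigcup (F : (set 'rV[R]_n)^nat) :
  (forall i, g_sigma_preimage coor (F i)) ->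
  g_sigma_preimage coor (\bigcup_i (F i)).
Proof. exact: sigma_algebra_bigcup. Qed.

Definition row_display : measure_display. Proof. exact. Qed.

HB.instance Definition _ := @isMeasurable.Build row_display
  'rV[R]_n (g_sigma_preimage coor) row_set0 row_setC row_bigcup.

End row_measurable.

Lemma measurable_coord (R : realType) n (i : 'I_n) :
  measurable_fun [set: 'rV[R]_n] (fun x : 'rV[R]_n => x 0 i : measurableTypeR R).
Proof.
move=> _ Y mY; rewrite setTI; apply: sub_sigma_algebra => /=.
rewrite -bigcup_seq/=; exists i => /=; first by rewrite mem_index_enum.
by exists Y => //; rewrite setTI.
Qed.

Lemma measurable_fun_row d (T : measurableType d) (R : realType) n
    (f : T -> 'rV[R]_n) :
  (forall i, measurable_fun [set: T] (fun t => f t 0 i : measurableTypeR R)) ->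
  measurable_fun [set: T] f.
Proof.
move=> mf.
have sub : g_sigma_preimage (fun i t => f t 0 i : measurableTypeR R) `<=`
    @measurable _ T.
  apply: smallest_sub; first exact: sigma_algebra_measurable.
  case: n => [|n] in f mf *; first by rewrite big_ord0.
  rewrite -bigcup_mkord_ord; apply: bigcup_sub => i Ii.
  by move=> A [B mB <-]; exact: mf.
move=> _ A mA; apply: sub.
by rewrite (g_sigma_preimage_comp (fun i (x : 'rV[R]_n) => x 0 i : measurableTypeR R) f); exists A.
Qed.

(* The image of a measure under a measurable map. *)
Section image_measure.
Context d d' (T : measurableType d) (T' : measurableType d') (R : realType).
Variables (m : {measure set T -> \bar R}) (X : {mfun T >-> T'}).

Definition image_measure : set T' -> \bar R := pushforward m X.

Let image0 : image_measure set0 = 0%E.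
Proof. exact: measure0. Qed.

Let image_ge0 A : (0 <= image_measure A)%E.
Proof. exact: measure_ge0. Qed.

Let image_sigma_additive : semi_sigma_additive image_measure.
Proof. exact: measure_semi_sigma_additive. Qed.

HB.instance Definition _ := isMeasure.Build _ _ _ image_measure
  image0 image_ge0 image_sigma_additive.

End image_measure.

Section cons_row.
Context {R : realType} (n : nat).

Definition cons_row (p : measurableTypeR R * 'rV[R]_n) : 'rV[R]_n.+1 :=
  \row_j oapp (fun i => p.2 0 i) p.1 (unlift ord0 j).

Let measurable_cons_row : measurable_fun [set: _] cons_row.
Proof.
apply: measurable_fun_row => i; rewrite /cons_row.
have [j|] := unliftP ord0 i.
  move=> ->; under eq_fun do rewrite mxE liftK /=.
  exact: (measurableT_comp (measurable_coord j) measurable_snd).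
move=> ->; under eq_fun do rewrite mxE unlift_none /=.
exact: measurable_fst.
Qed.

HB.instance Definition _ :=
  isMeasurableFun.Build _ _ _ _ cons_row measurable_cons_row.

End cons_row.

Section cons_measure.
Context {R : realType} (n : nat).
Variable m1 : {sigma_finite_measure set (measurableTypeR R) -> \bar R}.
Variable m : {sigma_finite_measure set 'rV[R]_n -> \bar R}.

Definition cons_measure : set 'rV[R]_n.+1 -> \bar R :=
  image_measure (m1 \x m)%E (@cons_row R n).

HB.instance Definition _ := Measure.on cons_measure.

Let uncons (x : 'rV[R]_n.+1) : measurableTypeR R * 'rV[R]_n :=
  (x 0 ord0, \row_j x 0 (lift ord0 j)).

Let cons_rowK : cancel (@cons_row R n) uncons.
Proof.
move=> [x y]; rewrite /uncons /cons_row !mxE unlift_none /=; congr pair.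
by apply/rowP => j; rewrite !mxE liftK.
Qed.

Let measurable_uncons : measurable_fun [set: _] uncons.
Proof.
apply/prod_measurable_funP; split; first exact: measurable_coord.
apply: measurable_fun_row => j /=.
under eq_fun do rewrite mxE.
exact: measurable_coord.
Qed.

Let cons_measure_sigma_finite : sigma_finite [set: _] cons_measure.
Proof.
have /sigma_finiteP[F [TF ndF Foo]] := sigma_finiteT m1.
have /sigma_finiteP[G [TG ndG Goo]] := sigma_finiteT m.
exists (fun k => uncons @^-1` (F k `*` G k)).
  rewrite -preimage_bigcup -[LHS](preimage_setT uncons); congr preimage.
  rewrite -setXTT TF TG predeqE => -[x y]; split.
    move=> [/= [i _ Fix] [k _ Gky]]; exists (maxn i k) => //; split.
    - by move: x Fix; exact/subsetPset/ndF/leq_maxl.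
    - by move: y Gky; exact/subsetPset/ndG/leq_maxr.
  by move=> [i _ []/= ? ?]; split; exists i.
move=> k; have [? ?] := Foo k; have [? ?] := Goo k.
split.
  rewrite -[X in measurable X]setTI; apply: measurable_uncons => //.
  exact: measurableX.
rewrite /cons_measure /image_measure /pushforward /=.
rewrite -comp_preimage (_ : _ \o _ = id) ?preimage_id.
  by rewrite product_measure1E// lte_mul_pinfty// ge0_fin_numE.
by apply/funext => x /=; rewrite cons_rowK.
Qed.

HB.instance Definition _ := Measure_isSigmaFinite.Build _ _ _ cons_measure
  cons_measure_sigma_finite.

End cons_measure.

Fixpoint lebesgue_rV (R : realType) (n : nat) :
    {sigma_finite_measure set 'rV[R]_n -> \bar R} :=
  match n with
  | 0%N => [the {sigma_finite_measure set 'rV[R]_0 -> \bar R} of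
            \d_ (0 : 'rV[R]_0)]
  | n'.+1 => [the {sigma_finite_measure set 'rV[R]_n'.+1 -> \bar R} of
              cons_measure (@lebesgue_measure R) (lebesgue_rV R n')]
  end.

Section geometry.
Context {R : realType} {d : nat}.
Local Notation E := 'rV[R]_d.

Definition dot (x y : E) : R := \sum_i x 0 i * y 0 i.

(* The library norm on row vectors is the sup norm. *)
Definition enorm (x : E) : R := Num.sqrt (dot x x).

Definition diam (A : set E) : R :=
  sup [set r | exists x y, [/\ A x, A y & r = enorm (x - y)]].

Definition boundary (A : set E) : set E := closure A `\` A°.

(* A pair (nu, c) with nu a unit vector stands for {x | nu . x = c}. *)
Definition hyperplane (p : E * R) : set E := [set x | dot p.1 x = p.2].

Definition slab (p : E * R) : set E := [set x | 0 <= dot p.1 x - p.2 <= 1].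

Definition hyperplane_proj (p : E * R) (x : E) : E :=
  x - (dot p.1 x - p.2) *: p.1.

Lemma measurable_dot (nu : E) :
  measurable_fun [set: E] (fun x => dot nu x : measurableTypeR R).
Proof.
apply: measurable_sum => i.
by apply: measurable_funM => //; exact: measurable_coord.
Qed.

Lemma measurable_slab (p : E * R) : measurable (slab p).
Proof.
have -> : slab p = (fun x => dot p.1 x - p.2) @^-1` `[0, 1]%classic.
  by apply/seteqP; split => x; rewrite /slab /= in_itv.
rewrite -[X in measurable X]setTI; apply: (measurable_funB _ _) => //.
exact: measurable_dot.
Qed.

Let measurable_hyperplane_proj (p : E * R) :
  measurable_fun [set: E] (hyperplane_proj p).
Proof.
apply: measurable_fun_row => i.
under eq_fun do rewrite !mxE.
apply: measurable_funB; first exact: measurable_coord.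
apply: measurable_funM => //; apply: measurable_funB => //.
exact: measurable_dot.
Qed.

HB.instance Definition _ (p : E * R) :=
  isMeasurableFun.Build _ _ _ _ (hyperplane_proj p)
    (measurable_hyperplane_proj p).

(* (d-1)-dimensional area on a hyperplane: the area of A is the volume of the
   right prism of unit height over A. *)
Definition hyperplane_measure (p : E * R) : {measure set E -> \bar R} :=
  [the {measure set E -> \bar R} of
   image_measure
     [the {measure set E -> \bar R} of
      mrestr (lebesgue_rV R d) (measurable_slab p)]
     [the {mfun E >-> E} of hyperplane_proj p]].

(* On the boundary of a polyhedral domain, with H listing without repetition
   the hyperplanes that carry its facets, this is the surface measure: two
   distinct hyperplanes meet in a null set. *)
Definition surface_measure (H : seq (E * R)) : {measure set E -> \bar R} :=
  [the {measure set E -> \bar R} of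
   msum (fun k => hyperplane_measure (nth (0, 0) H k)) (size H)].

(* Near each boundary point the set is, after a rotation, the strict epigraph
   of a Lipschitz function of the coordinates orthogonal to e. *)
Definition lipschitz_boundary (Omega : set E) : Prop :=
  forall x, boundary Omega x ->
    exists (r : R) (e : E) (L : R) (psi : E -> R),
      [/\ 0 < r, enorm e = 1,
          forall y z, `|psi y - psi z| <= L * enorm (y - z) &
          forall y, enorm (y - x) < r ->
            (Omega y <-> psi (y - dot y e *: e) < dot y e)].

Record polyhedral_lipschitz_domain (H : seq (E * R)) (Omega : set E) : Prop :=
  PolyhedralLipschitzDomain {
    domain_nonempty : Omega !=set0;
    domain_open : open Omega;
    domain_connected : connected Omega;
    domain_bounded : bounded_set Omega;
    domain_lipschitz : lipschitz_boundary Omega;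
    planes_uniq : uniq H;
    planes_unit : {in H, forall p, enorm p.1 = 1};
    planes_distinct :
      {in H &, forall p q, hyperplane p = hyperplane q -> p = q};
    domain_polyhedral :
      boundary Omega `<=` [set x | exists2 p, p \in H & hyperplane p x] }.

Record boundary_decomposition (Omega GammaD GammaC : set E) : Prop :=
  BoundaryDecomposition {
    GammaD_open : exists2 U, open U & GammaD = boundary Omega `&` U;
    GammaC_open : exists2 U, open U & GammaC = boundary Omega `&` U;
    Gamma_disjoint : GammaD `&` GammaC = set0;
    Gamma_cover : closure GammaD `|` closure GammaC = boundary Omega }.

End geometry.

Section spaces.
Context {R : realType} {d : nat}.
Local Notation E := 'rV[R]_d.
Implicit Types (mu : {measure set E -> \bar R}) (D : set E).

Definition L2 mu D (f : E -> R) : Prop :=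
  measurable_fun D f /\
  (\int[mu]_(x in D) ((f x) ^+ 2)%:E < +oo)%E.

Definition L2_inner mu D (f g : E -> R) : R := \int[mu]_(x in D) (f x * g x).

Definition L2_sqnorm mu D (f : E -> R) : R := L2_inner mu D f f.

Definition L2_vinner mu D (F G : E -> E) : R :=
  \int[mu]_(x in D) dot (F x) (G x).

Definition L2_vsqnorm mu D (F : E -> E) : R := L2_vinner mu D F F.

Definition L2_cvg mu D (u : nat -> E -> R) (v : E -> R) : Prop :=
  (\int[mu]_(x in D) ((u n x - v x) ^+ 2)%:E)%E @[n --> \oo] --> (0 : \bar R)%E.

Definition pderiv (i : 'I_d) (f : E -> R) : E -> R :=
  fun x => 'D_(delta_mx 0 i) f x.

(* C^infty: all iterated partial derivatives exist and are continuous. *)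
Definition smooth (f : E -> R) : Prop :=
  forall s : seq 'I_d, continuous (foldr pderiv f s) /\
    forall i x, derivable (foldr pderiv f s) x (delta_mx 0 i).

Definition test_function (Omega : set E) (phi : E -> R) : Prop :=
  smooth phi /\ exists K, [/\ compact K, K `<=` Omega &
                              forall x, ~ K x -> phi x = 0].

Definition weak_gradient (Omega : set E) (v : E -> R) (G : E -> E) : Prop :=
  forall phi, test_function Omega phi -> forall i,
    L2_inner (lebesgue_rV R d) Omega v (pderiv i phi) =
    - L2_inner (lebesgue_rV R d) Omega (fun x => G x 0 i) phi.

(* v belongs to H^1(Omega) and G represents its gradient. *)
Record H1 (Omega : set E) (v : E -> R) (G : E -> E) : Prop := IsH1 {
  H1_val : L2 (lebesgue_rV R d) Omega v;
  H1_grad : forall i, L2 (lebesgue_rV R d) Omega (fun x => G x 0 i);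
  H1_weak : weak_gradient Omega v G }.

Definition H1_sqnorm (Omega : set E) (v : E -> R) (G : E -> E) : R :=
  L2_sqnorm (lebesgue_rV R d) Omega v + L2_vsqnorm (lebesgue_rV R d) Omega G.

(* The trace is the continuous extension to H^1(Omega) of the restriction to
   the boundary of functions smooth up to the boundary. *)
Definition trace (H : seq (E * R)) (Omega : set E) (v : E -> R) (G : E -> E)
    (tau : E -> R) : Prop :=
  L2 (surface_measure H) (boundary Omega) tau /\
  exists u : nat -> E -> R,
    [/\ forall n, smooth (u n),
        L2_cvg (lebesgue_rV R d) Omega u v,
        forall i, L2_cvg (lebesgue_rV R d) Omega
                    (fun n => pderiv i (u n)) (fun x => G x 0 i) &
        L2_cvg (surface_measure H) (boundary Omega) u tau].

(* v belongs to V = {v in H^1(Omega) | v = 0 on Gamma_D}, with gradient G. *)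
Definition in_V (H : seq (E * R)) (Omega GammaD : set E)
    (v : E -> R) (G : E -> E) : Prop :=
  H1 Omega v G /\
  exists2 tau, trace H Omega v G tau &
    {ae surface_measure H, forall x, GammaD x -> tau x = 0}.

(* Sobolev-Slobodeckij space; the exponent of |x - y| is (d-1) + 2 * (1/2). *)
Definition H_half (H : seq (E * R)) (GammaC : set E) (g : E -> R) : Prop :=
  L2 (surface_measure H) GammaC g /\
  (\int[surface_measure H]_(x in GammaC) \int[surface_measure H]_(y in GammaC)
     ((g x - g y) ^+ 2 / enorm (x - y) ^+ d)%:E < +oo)%E.

End spaces.

Section simplices.
Context {R : realType} {d : nat}.
Local Notation E := 'rV[R]_d.
Implicit Type a : 'I_d.+1 -> E.

Definition simplex a : set E :=
  [set x | exists l : 'I_d.+1 -> R,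
    [/\ forall i, 0 <= l i, \sum_i l i = 1 & x = \sum_i l i *: a i]].

(* The face opposite to the vertex a j. *)
Definition face a (j : 'I_d.+1) : set E :=
  [set x | exists l : 'I_d.+1 -> R,
    [/\ forall i, 0 <= l i, l j = 0, \sum_i l i = 1 &
        x = \sum_i l i *: a i]].

Definition affinely_independent a : Prop :=
  forall l : 'I_d.+1 -> R,
    \sum_i l i = 0 -> \sum_i l i *: a i = 0 -> forall i, l i = 0.

Definition is_outward_normal a (j : 'I_d.+1) (nu : E) : Prop :=
  [/\ enorm nu = 1,
      forall i k, i != j -> k != j -> dot nu (a i - a k) = 0 &
      forall i, i != j -> 0 < dot nu (a i - a j)].

Definition outward_normal a (j : 'I_d.+1) : E := get (is_outward_normal a j).

End simplices.

Record mesh (R : realType) (d : nat) := Mesh {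
  nelt : nat;
  elt : 'I_nelt -> 'I_d.+1 -> 'rV[R]_d }.

Arguments elt {R d} m _ _.

Section mesh_theory.
Context {R : realType} {d : nat}.
Local Notation E := 'rV[R]_d.
Implicit Type T : mesh R d.

Record is_partition (Omega : set E) T : Prop := IsPartition {
  elt_nondegenerate : forall i, affinely_independent (elt T i);
  elt_cover : closure Omega = \bigcup_i simplex (elt T i);
  elt_disjoint : forall i j, i != j ->
    (simplex (elt T i))° `&` (simplex (elt T j))° = set0 }.

(* The part Gamma of the boundary is resolved by faces of elements. *)
Definition boundary_fitted (Gamma : set E) T : Prop :=
  forall x, closure Gamma x -> exists i j,
    face (elt T i) j `<=` closure Gamma /\ face (elt T i) j x.

Definition shape_regular (kappa : R) T : Prop :=
  forall i, exists c : E, forall x,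
    enorm (x - c) <= kappa * diam (simplex (elt T i)) -> simplex (elt T i) x.

Definition quasiuniform (q h : R) T : Prop :=
  forall i, q * h <= diam (simplex (elt T i)) <= h.

Definition poly_eval (p : mpoly.mpoly d R) (x : E) : R :=
  mpoly.meval (fun i => x 0 i) p.

Definition poly_grad (p : mpoly.mpoly d R) (x : E) : E :=
  \row_i poly_eval (mpoly.mderiv i p) x.

(* The polynomial that coincides with v on the i-th element, unique because
   elements have nonempty interior. *)
Definition local_poly T (v : E -> R) i : mpoly.mpoly d R :=
  xget 0 [set p | forall x, simplex (elt T i) x -> v x = poly_eval p x].
Arguments local_poly : clear implicits.

(* The gradient of a piecewise polynomial, with an arbitrary choice of element
   on the (null) set of points that belong to several of them. *)
Definition gradh T (v : E -> R) (x : E) : E :=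
  if [pick i | `[< simplex (elt T i) x >]] is Some i
  then poly_grad (local_poly T v i) x else 0.

(* The normal derivative of v on Gamma_C, computed from the element adjacent to
   the face that contains x; again arbitrary where faces meet. *)
Definition sigma_n T (GammaC : set E) (v : E -> R) (x : E) : R :=
  if [pick ij | `[< face (elt T ij.1) ij.2 `<=` closure GammaC /\
                    face (elt T ij.1) ij.2 x >]] is Some ij
  then dot (poly_grad (local_poly T v ij.1) x)
           (outward_normal (elt T ij.1) ij.2)
  else 0.

(* The continuous piecewise polynomials of degree at most k in V. The weak
   gradient of such a function is its piecewise gradient, which is therefore
   the representative used throughout. Only the values on the closure of Omega
   are meaningful. *)
Definition Vh (H : seq (E * R)) (Omega GammaD : set E) (k : nat) T :
    set (E -> R) :=
  [set v | [/\ in_V H Omega GammaD v (gradh T v),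
               {within closure Omega, continuous v} &
               forall i, exists2 p : mpoly.mpoly d R,
                 (mpoly.msize p <= k.+1)%N &
                 forall x, simplex (elt T i) x -> v x = poly_eval p x]].

End mesh_theory.

Section method.
Context {R : realType} {d : nat}.
Local Notation E := 'rV[R]_d.

Definition form_a (Omega : set E) (T : mesh R d) (v w : E -> R) : R :=
  L2_vinner (lebesgue_rV R d) Omega (gradh T v) (gradh T w).

Definition form_l (Omega : set E) (f w : E -> R) : R :=
  L2_inner (lebesgue_rV R d) Omega f w.

Definition phi_plus (s t : R) : R := t / 2 + Num.sqrt (t ^+ 2 / 4 + s).

Definition opDP (T : mesh R d) (GammaC : set E) (gamma : R) (w : E -> R) :
    E -> R :=
  fun x => w x - sigma_n T GammaC w x / gamma.

Definition opP (T : mesh R d) (GammaC : set E) (gamma : R) (g v : E -> R) :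
    E -> R :=
  fun x => (v x - g x) - sigma_n T GammaC v x / gamma.

Definition form_A (H : seq (E * R)) (Omega GammaC : set E) (T : mesh R d)
    (g : E -> R) (gamma s : R) (v w : E -> R) : R :=
  form_a Omega T v w
  - gamma^-1 * L2_inner (surface_measure H) GammaC
                 (sigma_n T GammaC v) (sigma_n T GammaC w)
  + gamma * L2_inner (surface_measure H) GammaC
              (fun x => phi_plus s (opP T GammaC gamma g v x))
              (opDP T GammaC gamma w).

End method.

(* Main.v *)
Require Import Defs.
From HB Require Import structures.
From mathcomp Require Import all_boot all_order all_algebra.
From mathcomp Require Import all_classical all_reals all_analysis.
From mathcomp Require Import measurable_realfun ring lra.
From mathcomp Require mpoly.

Import (canonicals, coercions) mpoly.

Set Implicit Arguments.
Unset Strict Implicit.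
Unset Printing Implicit Defensive.

Import Order.TTheory GRing.Theory Num.Theory.
Import numFieldNormedType.Exports.

Local Open Scope classical_set_scope.
Local Open Scope ring_scope.

(** The form is strongly monotone on V_h: since phi_plus is nondecreasing, the
    penalty term contributes a nonnegative amount, the trace inverse inequality
    absorbs the stabilisation term into (C_I / gamma_0) a(w, w), and the
    Poincare inequality bounds the remaining C a(w, w) from below. As phi_plus
    is 1-Lipschitz, the form is Lipschitz in its first argument. Recording the
    coefficients of its local polynomials identifies V_h, up to values outside
    the closure of Omega, with a finite-dimensional space, and there the
    Zarantonello iteration x |-> x - t F x is a contraction.
    That V_h is a vector space on which the discrete gradient and the discrete
    normal derivative are linear rests on a polynomial being determined by its
    values on a nondegenerate simplex. *)

(** Members of [Vh] are functions on all of R^d that are constrained only on the closure of Omega,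
    so as a set of functions the space is infinite-dimensional. The abstract existence result
    therefore lets the coordinate map have a kernel and asks only that this kernel be invisible to
    both sides of the equation; uniqueness is likewise a statement about the closure. The penalty
    term is monotone because P is affine with linear part DP: against the test function v1 - v2, the
    factor DP(v1 - v2) equals P(v1) - P(v2), in which the obstacle g cancels. Real-valued integrals
    are additive only for integrable integrands, so every linearity claim about the forms needs
    membership in L2 first. On the contact boundary this comes from boundedness of polynomial data
    together with finiteness of the surface measure, and for g from the hypothesis on the
    obstacle. *)

(** * Lebesgue measure and Borel sets in R^n *)

Section rV_measure.
Context {R : realType}.

(** A closed sup-norm ball, written by coordinates so that it splits as a product along [cons_row]
    and its volume follows by induction on n. *)
Definition rV_box n (c : 'rV[R]_n) (r : R) : set 'rV[R]_n :=
  [set x | forall i, `|x 0 i - c 0 i| <= r].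

Lemma measurable_rV_box n (c : 'rV[R]_n) r : measurable (rV_box c r).
Proof.
have -> : rV_box c r = \bigcap_(i in [set: 'I_n])
    ((fun x : 'rV[R]_n => x 0 i : measurableTypeR R) @^-1`
      `[c 0 i - r, c 0 i + r]%classic).
  apply/seteqP; split => x /= xc i; last first.
    by have := xc i I; rewrite /= in_itv/= ler_distl.
  by move=> _ /=; rewrite in_itv/= -ler_distl.
apply: fin_bigcap_measurable => // i _.
rewrite -[X in measurable X]setTI.
exact: (measurable_coord i).
Qed.

Lemma lebesgue_rV_box n (c : 'rV[R]_n) r : 0 <= r ->
  lebesgue_rV R n (rV_box c r) = ((r *+ 2) ^+ n)%:E.
Proof.
move=> r0; elim: n c => [|n IHn] c /=.
  rewrite diracE mem_set ?expr0//; last by move=> [].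
pose c' : 'rV[R]_n := \row_i c 0 (lift ord0 i).
rewrite /cons_measure /image_measure /pushforward.
have -> : @cons_row R n @^-1` rV_box c r =
    `[c 0 ord0 - r, c 0 ord0 + r]%classic `*` rV_box c' r.
  apply/seteqP; split => -[x y] /=.
    move=> xy; split.
      by have := xy ord0; rewrite mxE unlift_none /= in_itv/= -ler_distl.
    by move=> i; have := xy (lift ord0 i); rewrite !mxE liftK.
  move=> [xc yc] i; case: (unliftP ord0 i) => [j|] ->.
    by have := yc j; rewrite !mxE liftK.
  by move: xc; rewrite mxE unlift_none/= in_itv/= -ler_distl.
rewrite [LHS](_ : _ = (lebesgue_measure (`[(c 0 ord0 - r)%R,
  (c 0 ord0 + r)%R]%classic : set R) *
    lebesgue_rV R n (rV_box c' r))%E); last first.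
  apply: (product_measure1E (lebesgue_measure (R := R)) (lebesgue_rV R n)) =>
    //.
  exact: measurable_rV_box.
rewrite IHn lebesgue_measure_itv/= lte_fin.
have [r_gt0|] := ltP (c 0 ord0 - r) (c 0 ord0 + r).
  rewrite -EFinB -EFinM exprS; congr (_ * _)%:E.
  by rewrite opprB addrC addrA subrK mulr2n.
(* Endpoints that are not strictly ordered force the width to be zero, where both sides vanish. *)
rewrite -subr_ge0 => r_le0; have -> : r = 0 by lra.
by rewrite mul0e mul0rn expr0n.
Qed.

Lemma rat_approx (x e : R) : 0 < e -> exists q : rat, `|x - ratr q| < e.
Proof.
move=> e0; have /rat_in_itvoo[q] : x - e < x + e by lra.
rewrite in_itv/= => /andP[? ?]; exists q.
by rewrite distrC ltr_distl; apply/andP.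
Qed.

Lemma dist_half (a b c z e : R) :
  `|a - c| < z -> `|b - c| <= z -> z < e / 2 -> `|a - b| < e.
Proof.
rewrite !ltr_norml ler_norml => /andP[? ?] /andP[? ?] ?.
by apply/andP; split; lra.
Qed.

(** The sigma-algebra is generated by coordinates, not by open sets. An open set is the union of the
    countably many boxes inside it that have rational centres and radii 1/(m+1). *)
Lemma open_measurable_rV n (U : set 'rV[R]_n) : open U -> measurable U.
Proof.
move=> oU.
pose B (q : 'rV[rat]_n * nat) : set 'rV[R]_n :=
  rV_box (map_mx ratr q.1) (q.2.+1%:R^-1).
have -> : U = \bigcup_q (if `[< B q `<=` U >] then B q else set0).
  apply/seteqP; split => x; last by move=> [q _]; case: asboolP => // + Bqx;
    exact.
  move=> Ux; have /nbhs_ballP[e /= e0 xeU] := open_nbhs_nbhs (conj oU Ux).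
  have [m me] : exists m : nat, m.+1%:R^-1 < e / 2.
    have e20 : 0 < e / 2 by rewrite divr_gt0.
    have [m _ /(_ m (leqnn m)) mH] := near_infty_natSinv_lt (PosNum e20).
    by exists m.
  have m0 : 0 < (m.+1%:R : R)^-1 by rewrite invr_gt0.
  have /choice[q xq] i : exists q : rat, `|x 0 i - ratr q| < m.+1%:R^-1.
    exact: rat_approx.
  exists (\row_i q i, m) => //; case: asboolP => [_ i|].
    by rewrite !mxE ltW.
  apply: contra_notP => _ y Bqy; apply: xeU; split => // i j.
  rewrite (ord1 i) -ball_normE /=; apply: (dist_half (xq j) _ me).
  by have := Bqy j; rewrite !mxE.
apply: countable_bigcupT_measurable => // q.
by case: asboolP => // _; exact: measurable_rV_box.
Qed.

Lemma closed_measurable_rV n (A : set 'rV[R]_n) : closed A -> measurable A.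
Proof. by move/closed_openC/open_measurable_rV/measurableC; rewrite setCK. Qed.

Lemma compact_measurable_rV n (A : set 'rV[R]_n) : compact A -> measurable A.
Proof.
move=> /compact_closed cA; apply: closed_measurable_rV; apply: cA.
exact: norm_hausdorff.
Qed.

Lemma within_continuous_measurable_rV n (D : set 'rV[R]_n) (f : 'rV[R]_n -> R) :
  measurable D -> {within D, continuous f} ->
  measurable_fun D (f : 'rV[R]_n -> measurableTypeR R).
Proof.
move=> mD /continuousP cf; apply: (measurability _ (RGenOpens.measurableE R)).
move=> _ [_ [a [b ->] <-]].
have /open_subspaceP[V oV VD] : open (from_subspace D f @^-1` `]a, b[%classic).
  exact/cf/interval_open.
rewrite setIC -VD; apply: measurableI => //; exact: open_measurable_rV.
Qed.

Lemma bounded_rV_box n (A : set 'rV[R]_n) : bounded_set A ->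
  exists2 M, 0 < M & A `<=` rV_box 0 M.
Proof.
(* [bounded_set] gives a bound only strictly above M, which may be negative; this value is positive
   and above M. *)
move=> [M [_ AM]]; exists (`|M| + 1); first by rewrite ltr_wpDl.
have M1 : M < `|M| + 1 by rewrite (le_lt_trans (ler_norm M))// ltrDl.
move=> x /(AM _ M1) xM i.
rewrite mxE subr0 (le_trans _ xM)//.
by rewrite [leRHS]/Num.norm/= mx_normrE; apply/bigmax_geP; right; exists (0, i).
Qed.

Lemma bounded_lebesgue_rV n (A : set 'rV[R]_n) :
  measurable A -> bounded_set A -> (lebesgue_rV R n A < +oo)%E.
Proof.
move=> mA /bounded_rV_box[M M0 AM].
apply: (@le_lt_trans _ _ (lebesgue_rV R n (rV_box 0 M))).
  by apply: le_measure; rewrite ?inE//; exact: measurable_rV_box.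
by rewrite lebesgue_rV_box ?ltry// ltW.
Qed.

(** This is what makes the L2 norm definite on continuous functions. *)
Lemma open_lebesgue_rV_gt0 n (U : set 'rV[R]_n) :
  open U -> U !=set0 -> (0 < lebesgue_rV R n U)%E.
Proof.
move=> oU [x Ux].
have /nbhs_ballP[e /= e0 xeU] := open_nbhs_nbhs (conj oU Ux).
have e20 : 0 < e / 2 by rewrite divr_gt0.
apply: (@lt_le_trans _ _ (lebesgue_rV R n (rV_box x (e / 2)))).
  by rewrite lebesgue_rV_box ?lte_fin ?exprn_gt0 ?mulrn_wgt0// ltW.
apply: le_measure; rewrite ?inE.
- exact: measurable_rV_box.
- exact: open_measurable_rV.
- move=> y xy; apply: xeU; split => // i j;
  rewrite (ord1 i) -ball_normE /= distrC.
  apply: le_lt_trans (xy j) _; lra.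
Qed.

End rV_measure.

(** * Square-integrable functions over a measurable set *)

Section L2_theory.
Context {R : realType} {d : nat}.
Local Notation E := 'rV[R]_d.
Variables (mu : {measure set E -> \bar R}) (D : set E).
Hypothesis mD : measurable D.
Implicit Types f g u v : E -> R.

Lemma L2_sqr_integrable f :
  L2 mu D f -> mu.-integrable D (EFin \o (fun x => f x ^+ 2)).
Proof.
move=> [mf foo]; apply/integrableP; split.
  by apply/measurable_EFinP; apply: measurable_funX.
rewrite (eq_integral (fun x => (f x ^+ 2)%:E))// => x _ /=.
by rewrite ger0_norm// sqr_ge0.
Qed.

(** Domination by f^2 + g^2. *)
Lemma L2_mul_integrable f g :
  L2 mu D f -> L2 mu D g -> mu.-integrable D (EFin \o (fun x => f x * g x)).
Proof.
move=> Lf Lg.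
have iD := integrableD mD (L2_sqr_integrable Lf) (L2_sqr_integrable Lg).
apply: le_integrable iD => //.
  by apply/measurable_EFinP; apply: measurable_funM; [case: Lf|case: Lg].
move=> x _ /=; rewrite lee_fin.
rewrite [leRHS]ger0_norm ?addr_ge0 ?sqr_ge0//.
by rewrite ler_norml; apply/andP; split; nra.
Qed.

Lemma L2_lin (a b : R) f g :
  L2 mu D f -> L2 mu D g -> L2 mu D (fun x => a * f x + b * g x).
Proof.
move=> Lf Lg; have [mf _] := Lf; have [mg _] := Lg.
have mh : measurable_fun D (fun x => a * f x + b * g x).
  by apply: measurable_funD; apply: measurable_funM.
split => //.
have iD := integrableD mD
  (integrableZl mD (2 * a ^+ 2) (L2_sqr_integrable Lf))
  (integrableZl mD (2 * b ^+ 2) (L2_sqr_integrable Lg)).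
have /integrableP[_] : mu.-integrable D
    (EFin \o (fun x => (a * f x + b * g x) ^+ 2)).
  apply: le_integrable iD => //.
    by apply/measurable_EFinP; apply: measurable_funX.
  move=> x _ /=; rewrite lee_fin.
  rewrite ger0_norm ?sqr_ge0// ger0_norm; last first.
    by apply: addr_ge0; apply: mulr_ge0; rewrite ?sqr_ge0// mulr_ge0// sqr_ge0.
  (* This square is exactly the gap between 2 (a f)^2 + 2 (b g)^2 and (a f + b g)^2. *)
  by have := sqr_ge0 (a * f x - b * g x); lra.
apply: le_lt_trans; rewrite le_eqVlt; apply/orP; left; apply/eqP.
by apply: eq_integral => x _ /=; rewrite ger0_norm// sqr_ge0.
Qed.

Lemma L2D f g : L2 mu D f -> L2 mu D g -> L2 mu D (fun x => f x + g x).
Proof. by move=> /(L2_lin 1 1)/[apply]; under eq_fun do rewrite !mul1r. Qed.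

Lemma L2B f g : L2 mu D f -> L2 mu D g -> L2 mu D (fun x => f x - g x).
Proof. by move=> /(L2_lin 1 (-1))/[apply];
  under eq_fun do rewrite mul1r mulN1r. Qed.

Lemma L2_dominated f g : measurable_fun D (f : E -> measurableTypeR R) ->
  (forall x, D x -> `|f x| <= `|g x|) -> L2 mu D g -> L2 mu D f.
Proof.
move=> mf fg Lg; split => //; have [mg] := Lg.
apply: le_lt_trans; apply: ge0_le_integral => //.
- by move=> x _; rewrite lee_fin sqr_ge0.
- by apply/measurable_EFinP; apply: measurable_funX.
- by apply/measurable_EFinP; apply: measurable_funX.
- move=> x Dx; rewrite lee_fin.
  rewrite -(real_normK (num_real (f x))) -(real_normK (num_real (g x))).
  by rewrite ler_sqr ?nnegrE// fg.
Qed.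

Lemma L2_cst a : (mu D < +oo)%E -> L2 mu D (fun=> a).
Proof.
move=> Doo; split => //.
by rewrite integral_cst// lte_mul_pinfty// ?lee_fin ?sqr_ge0.
Qed.

Lemma L2_norm f : L2 mu D f -> L2 mu D (fun x => `|f x|).
Proof.
move=> Lf; have [mf _] := Lf; apply: L2_dominated Lf => [|x _].
  exact: measurableT_comp.
by rewrite normr_id.
Qed.

Lemma L2_innerC f g : L2_inner mu D f g = L2_inner mu D g f.
Proof. by rewrite /L2_inner; under eq_Rintegral do rewrite mulrC. Qed.

Lemma L2_inner_lin (a b : R) f g h : L2 mu D f -> L2 mu D g -> L2 mu D h ->
  L2_inner mu D (fun x => a * f x + b * g x) h =
  a * L2_inner mu D f h + b * L2_inner mu D g h.
Proof.
move=> Lf Lg Lh; rewrite /L2_inner.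
under eq_Rintegral do rewrite mulrDl -!mulrA.
rewrite RintegralD//; last 2 first.
- have /= := integrableZl mD a (L2_mul_integrable Lf Lh).
  by apply: eq_integrable.
- have /= := integrableZl mD b (L2_mul_integrable Lg Lh).
  by apply: eq_integrable.
by rewrite !RintegralZl//; exact: L2_mul_integrable.
Qed.

Lemma eq_L2_inner f f' g g' : {in D, f =1 f'} -> {in D, g =1 g'} ->
  L2_inner mu D f g = L2_inner mu D f' g'.
Proof. by move=> ff gg; apply: eq_Rintegral => x Dx; rewrite ff// gg. Qed.

Lemma L2_inner_ge0 f g : (forall x, D x -> 0 <= f x * g x) ->
  0 <= L2_inner mu D f g.
Proof. exact: Rintegral_ge0. Qed.

Lemma le_L2_inner f f' g g' : L2 mu D f -> L2 mu D g -> L2 mu D f' ->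
  L2 mu D g' -> (forall x, D x -> f x * g x <= f' x * g' x) ->
  L2_inner mu D f g <= L2_inner mu D f' g'.
Proof. by move=> ? ? ? ? ?; apply: le_Rintegral => //;
  exact: L2_mul_integrable. Qed.

Lemma normr_L2_inner f g : L2 mu D f -> L2 mu D g ->
  `|L2_inner mu D f g| <= L2_inner mu D (fun x => `|f x|) (fun x => `|g x|).
Proof.
move=> Lf Lg; apply: le_trans (le_normr_Rintegral mD (L2_mul_integrable Lf Lg))
  _.
by under eq_Rintegral do rewrite normrM.
Qed.

(** The squared error of the combination is at most 2 a^2 and 2 b^2 times the two squared errors,
    and is squeezed to zero. Measurability serves to split the integral of this majorant. *)
Lemma L2_cvg_lin (a b : R) (u u' : nat -> E -> R) (v v' : E -> R) :
  (forall n, measurable_fun D (u n : E -> measurableTypeR R)) ->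
  (forall n, measurable_fun D (u' n : E -> measurableTypeR R)) ->
  measurable_fun D (v : E -> measurableTypeR R) ->
  measurable_fun D (v' : E -> measurableTypeR R) ->
  L2_cvg mu D u v -> L2_cvg mu D u' v' ->
  L2_cvg mu D (fun n x => a * u n x + b * u' n x)
              (fun x => a * v x + b * v' x).
Proof.
move=> mu_ mu'_ mv mv' uv uv'; rewrite /L2_cvg.
pose I (u : nat -> E -> R) v n := (\int[mu]_(x in D) ((u n x - v x) ^+ 2)%:E)%E.
have Ilim : (((2 * a ^+ 2)%:E * I u v n + (2 * b ^+ 2)%:E * I u' v' n)%E
    @[n --> \oo] --> 0%E).
  rewrite -[X in _ --> X]adde0 -[X in _ --> (X + _)%E](mule0 (2 * a ^+ 2)%:E).
  rewrite -[X in _ --> (_ + X)%E](mule0 (2 * b ^+ 2)%:E).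
  apply: cvgeD; first by rewrite !mule0 /adde_def.
    exact: cvgeZl.
  exact: cvgeZl.
refine (squeeze_cvge _ (cvg_cst 0%E) Ilim).
apply: nearW => n; apply/andP; split.
  by apply: integral_ge0 => x _; rewrite lee_fin sqr_ge0.
have mw (w w' : E -> R) : measurable_fun D (w : E -> measurableTypeR R) ->
    measurable_fun D (w' : E -> measurableTypeR R) ->
    measurable_fun D (fun x => ((w x - w' x) ^+ 2)%:E).
  by move=> ? ?; apply/measurable_EFinP; apply: measurable_funX;
    apply: measurable_funB.
have mlin (w w' : E -> R) : measurable_fun D (w : E -> measurableTypeR R) ->
    measurable_fun D (w' : E -> measurableTypeR R) ->
    measurable_fun D (fun x => a * w x + b * w' x : measurableTypeR R).
  by move=> ? ?; apply: measurable_funD; apply: measurable_funM.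
have c_ge0 (c r : R) : 0 <= 2 * c ^+ 2 * r ^+ 2.
  by rewrite mulr_ge0 ?sqr_ge0// mulr_ge0// sqr_ge0.
rewrite /I -!ge0_integralZl//; try by
  [exact: mw | move=> *; rewrite lee_fin sqr_ge0 | rewrite lee_fin mulr_ge0//
    sqr_ge0].
rewrite -ge0_integralD//; last 4 first.
- by move=> x _; rewrite -EFinM lee_fin; exact: c_ge0.
- by apply: measurable_funeM; exact: mw.
- by move=> x _; rewrite -EFinM lee_fin; exact: c_ge0.
- by apply: measurable_funeM; exact: mw.
apply: ge0_le_integral => //.
- by move=> x _; rewrite lee_fin sqr_ge0.
- by apply: mw; exact: mlin.
- by apply: emeasurable_funD; apply: measurable_funeM; exact: mw.
move=> x _; rewrite -!EFinM -EFinD lee_fin.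
have := sqr_ge0 (a * (u n x - v x) - b * (u' n x - v' x)); lra.
Qed.

End L2_theory.

(** * Multivariate polynomials that vanish on an open set *)

Section polynomial_identity.
Context {R : realType}.

Lemma poly_eq0_near0 (q : {poly R}) (e : R) :
  0 < e -> (forall t, `|t| < e -> q.[t] = 0) -> q = 0.
Proof.
move=> e0 q0; apply/eqP; apply: contraT => qn0.
suff : (size q < size q)%N by rewrite ltnn.
(* These are [size q] distinct roots, one more than the degree allows. Dividing by i + 2 keeps even
   the first of them strictly below e. *)
pose s := [seq e / i.+2%:R | i <- iota 0 (size q)].
rewrite -{1}(size_iota 0 (size q)) -(size_map (fun i => e / i.+2%:R)).
apply: max_poly_roots => //.
  apply/allP => _ /mapP[i _ ->]; apply/eqP/q0.
  rewrite gtr0_norm ?divr_gt0// ltr_pdivrMr// ltr_pMr//.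
  by rewrite (ltr_nat _ 1).
rewrite map_inj_uniq ?iota_uniq// => i j /(mulfI (lt0r_neq0 e0))/invr_inj/eqP.
by rewrite eqr_nat => /eqP[].
Qed.

(** [muni] reads p as a polynomial in its last variable over polynomials in the others. No
    coefficient gets lost, so p is zero once [muni p] has zero coefficients. *)
Lemma mcoeff_muni n (p : mpoly.mpoly n.+1 R) (m : mpoly.multinom n.+1) :
  mpoly.mcoeff (mpoly.Multinom [tuple m (widen_ord (leqnSn n) i) | i < n])
    (mpoly.muni p)`_(m ord_max) = mpoly.mcoeff m p.
Proof.
rewrite mpoly.muniE coef_sum.
under eq_bigr => m' _ do rewrite coefZ coefXn.
rewrite (linear_sum (mpoly.mcoeff _))/=.
rewrite [in RHS](mpoly.mpolyE p) (linear_sum (mpoly.mcoeff _))/=.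
apply: eq_bigr => m' _; rewrite mpoly.mcoeffZ mpoly.mcoeffX.
have [mm|mm] := eqVneq (m ord_max) (m' ord_max); last first.
  rewrite mulr0 mpoly.mcoeff0 [m' == m]negbTE ?mulr0//.
  by apply: contra_neq mm => ->.
rewrite mulr1 mpoly.mcoeffZ mpoly.mcoeffX; congr (_ * (nat_of_bool _)%:R).
apply/eqP/eqP => [/mpoly.mnmP mm'|->//].
apply/mpoly.mnmP => i; have [j|] := unliftP ord_max i; last by move=> ->.
move=> ->; have := mm' j; rewrite !mpoly.mnmE.
rewrite (_ : widen_ord _ j = lift ord_max j)//.
by apply: val_inj; rewrite /= /bump leqNgt ltn_ord.
Qed.

Lemma meval_muni n (p : mpoly.mpoly n.+1 R) (v : 'I_n.+1 -> R) :
  (map_poly (mpoly.meval (v \o widen_ord (leqnSn n))) (mpoly.muni p)).[v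
    ord_max]
  = mpoly.meval v p.
Proof.
rewrite mpoly.muniE [in RHS](mpoly.mpolyE p) !rmorph_sum/= horner_sum.
apply: eq_bigr => m _.
rewrite -mul_polyC rmorphM/= map_polyXn map_polyC/= hornerM hornerC hornerXn.
rewrite !mpoly.mevalZ !mpoly.mevalX -mulrA big_ord_recr/=; congr (_ * (_ * _)).
by apply: eq_bigr => i _; rewrite mpoly.mnmE.
Qed.

Lemma mpoly_eq0_eval n (p : mpoly.mpoly n R) :
  (forall v, mpoly.meval v p = 0) -> p = 0.
Proof.
elim: n p => [|n IHn] p p0.
  apply/mpoly.mpolyP => m; rewrite mpoly.mcoeff0.
  have := p0 (fun=> 0); rewrite [p in mpoly.meval _ p]mpoly.mpolyE.
  rewrite rmorph_sum/=.
  under eq_bigr do rewrite mpoly.mevalZ mpoly.mevalX big_ord0 mulr1.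
  have m0 (m' : mpoly.multinom 0) : m' = m by apply/mpoly.mnmP => -[].
  move=> s0; rewrite [in LHS](mpoly.mpolyE p) (linear_sum (mpoly.mcoeff m))/=
    -[RHS]s0.
  by apply: eq_bigr => m' _; rewrite mpoly.mcoeffZ mpoly.mcoeffX (m0 m') eqxx
    mulr1.
apply/mpoly.mpolyP => m; rewrite -mcoeff_muni mpoly.mcoeff0.
rewrite (IHn (mpoly.muni p)`_(m ord_max)) ?mpoly.mcoeff0// => v.
rewrite -(coef_map (mpoly.meval v)).
suff -> : map_poly (mpoly.meval v) (mpoly.muni p) = 0 by rewrite coef0.
apply: (@poly_eq0_near0 _ 1) => // t _.
pose w i := if unlift ord_max i is Some j then v j else t.
have wt : w ord_max = t by rewrite /w unlift_none.
rewrite -wt -[RHS](p0 w) -meval_muni; congr ((map_poly _ _).[_]).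
apply/funext => q; apply: mpoly.meval_eq => i /=.
rewrite /w (_ : widen_ord _ i = lift ord_max i) ?liftK//.
by apply: val_inj; rewrite /= /bump leqNgt ltn_ord.
Qed.

Lemma meval_line n (p : mpoly.mpoly n R) (u v : 'I_n -> R) (t : R) :
  (mpoly.mmap (@polyC R) (fun i => (u i)%:P + v i *: 'X) p).[t] =
  mpoly.meval (fun i => u i + v i * t) p.
Proof.
rewrite [p]mpoly.mpolyE !rmorph_sum/= horner_sum; apply: eq_bigr => m _.
rewrite mpoly.mmapZ mpoly.mmapX mpoly.mevalZ mpoly.mevalX hornerM hornerC.
rewrite /mpoly.mmap1 horner_prod; congr (_ * _); apply: eq_bigr => i _.
by rewrite horner_exp hornerD hornerC hornerZ hornerX.
Qed.

(** On the line from a point x of U to an arbitrary y, p is a univariate polynomial that vanishes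
    for parameters near 0. It is therefore zero, in particular at parameter 1, which is y. *)
Lemma mpoly_eq0_open n (p : mpoly.mpoly n R) (U : set 'rV[R]_n) :
  open U -> U !=set0 -> (forall x, U x -> poly_eval p x = 0) -> p = 0.
Proof.
move=> oU [x Ux] p0; apply: mpoly_eq0_eval => y.
pose v i := y i - x 0 i.
pose q := mpoly.mmap (@polyC R) (fun i => (x 0 i)%:P + v i *: 'X) p.
have cl : continuous (fun t : R => x + t *: (\row_i v i)).
  by move=> t; apply: cvgD; [exact: cvg_cst|exact: scalel_continuous].
have /nbhs_ballP[e /= e0 eU] : nbhs (0 : R) ((fun t =>
  x + t *: (\row_i v i)) @^-1` U).
  by apply: cl; rewrite /= scale0r addr0; apply: open_nbhs_nbhs.
suff q0 : q = 0.
  have := meval_line p (fun i => x 0 i) v 1; rewrite -/q q0 horner0 => ->.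
  by apply: mpoly.meval_eq => i; rewrite /v mulr1 addrC subrK.
apply: (poly_eq0_near0 e0) => t te; rewrite meval_line.
have /p0 : U (x + t *: (\row_i v i)) by apply: eU;
  rewrite -ball_normE /= sub0r normrN.
move=> pt; rewrite -[RHS]pt; apply: mpoly.meval_eq => i.
by rewrite !mxE mulrC.
Qed.

End polynomial_identity.

(** * Continuity of polynomials and measurability of finite selections *)

Section continuity.
Context {R : realType}.

Lemma continuous_bigsum (U : topologicalType) (V : normedModType R) (I : Type)
    (r : seq I) (F : I -> U -> V) :
  (forall i, continuous (F i)) -> continuous (fun x => \sum_(i <- r) F i x).
Proof.
move=> cF x; apply: (@cvg_big V I +%R 0 predT (@add_continuous V)) => i _.
exact: cF.
Qed.

Lemma continuous_bigprod (U : topologicalType) (I : Type)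
    (r : seq I) (F : I -> U -> R) :
  (forall i, continuous (F i)) -> continuous (fun x => \prod_(i <- r) F i x).
Proof.
move=> cF x; exact: (@cvg_big R I *%R 1 predT mul_continuous _ (nbhs x) r F (F
  ^~ x) _
  (fun i _ => cF i x)).
Qed.

Lemma continuous_poly_eval d (p : mpoly.mpoly d R) :
  continuous (poly_eval p).
Proof.
rewrite /poly_eval /mpoly.meval /mpoly.mmap.
apply: (@continuous_bigsum _ R^o) => m x.
apply: (@continuousM R 'rV[R]_d (cst _)) => /=; first exact: cst_continuous.
apply: continuous_bigprod => i {}x.
apply: (@continuous_comp _ _ _ (fun y : 'rV[R]_d => y 0 i) (fun t => t ^+ m i)).
  exact: coord_continuous.
exact: exprn_continuous.
Qed.

(** [sigma_n] has this shape. Since [pick] returns the first hit of the enumeration, the function is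
    a nested conditional over measurable sets, and induction on the enumeration applies. *)
Lemma measurable_pick d (T : measurableType d) (I : finType)
    (P : I -> set T) (F : I -> T -> R) :
  (forall i, measurable (P i)) ->
  (forall i, measurable_fun setT (F i : T -> measurableTypeR R)) ->
  measurable_fun setT
    (fun x => if [pick i | `[< P i x >]] is Some i then F i x else 0
      : measurableTypeR R).
Proof.
move=> mP mF; rewrite /pick /enum_mem.
elim: (Finite.enum I) => [|i s IHs] /=; first exact: measurable_cst.
pose G := fun x => if `[< P i x >] then F i x else
  if ohead [seq j <- s | `[< P j x >]] is Some j then F j x else 0.
rewrite (_ : (fun x => _) = G); last first.
  by apply/funext => x; rewrite /G unfold_in /=; case: ifP.
apply: measurable_fun_ifT; [|exact: mF|exact: IHs].
apply: (measurable_fun_bool true); rewrite setTI.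
rewrite (_ : _ @^-1` _ = P i); last first.
  by apply/seteqP; split => x /=; case: asboolP.
exact: mP.
Qed.

End continuity.

(** * Simplices and their faces *)

Section simplex_theory.
Context {R : realType} {d : nat}.
Local Notation E := 'rV[R]_d.
Implicit Type a : 'I_d.+1 -> E.

(** A face is the continuous image of a compact set of barycentric coordinates. Compactness provides
    the measurability on which [sigma_n] depends. *)
Lemma compact_face a j : compact (face a j).
Proof.
pose K : set 'rV[R]_d.+1 :=
  [set l | (forall i, 0 <= l 0 i <= 1) /\ (l 0 j = 0 /\ \sum_i l 0 i = 1)].
have cK : compact K.
  apply: (@subclosed_compact _ _ [set l : 'rV[R]_d.+1 | forall i, `[0,
    1]%classic (l 0 i)]).
  - rewrite (_ : K = \bigcap_i ((fun l : 'rV[R]_d.+1 =>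
    l 0 i) @^-1` `[0, 1]%classic)
        `&` ((fun l : 'rV[R]_d.+1 => l 0 j) @^-1` [set 0] `&`
             (fun l : 'rV[R]_d.+1 => \sum_i l 0 i) @^-1` [set 1])); last first.
      apply/seteqP; split => l.
        by move=> [l01 [lj ls]]; split => // i _ /=; rewrite in_itv/= l01.
      by move=> [l01 [lj ls]]; split => // i; have := l01 i I;
        rewrite /= in_itv/=.
    have cl (i : 'I_d.+1) : continuous (fun l : 'rV[R]_d.+1 => l 0 i).
      exact: coord_continuous.
    apply: closedI; last apply: closedI.
    + apply: closed_bigI => i _; apply: (closed_comp (fun l _ => cl i l)).
      exact: itv_closed.
    + by apply: (closed_comp (fun l _ => cl j l)); exact: closed_eq.
    + apply: closed_comp; last exact: closed_eq.
      by move=> l _; apply: (@continuous_bigsum R _ R^o).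
  - by apply: (@rV_compact R _ (fun=> `[0, 1]%classic)) => _;
    exact: segment_compact.
  - by move=> l [l01 _] i; rewrite /= in_itv/= l01.
have -> : face a j = (fun l : 'rV[R]_d.+1 => \sum_i l 0 i *: a i) @` K.
  apply/seteqP; split => x.
    move=> [l [l0 lj ls ->]]; exists (\row_i l i); last first.
      by apply: eq_bigr => i _; rewrite mxE.
    split=> [i|]; last by split; [rewrite mxE|under eq_bigr do rewrite mxE].
    by rewrite mxE l0 -ls (bigD1 i)//= lerDl sumr_ge0.
  move=> [l [l01 [lj ls]] <-]; exists (fun i => l 0 i); split => // i.
  by have /andP[] := l01 i.
apply: continuous_compact => //; apply: continuous_subspaceT.
apply: continuous_bigsum => i l.
apply: (@continuous_comp _ _ _ (fun l : 'rV[R]_d.+1 => l 0 i) (fun k =>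
  k *: a i)).
  exact: coord_continuous.
exact: scalel_continuous.
Qed.

Lemma simplex_interior a : affinely_independent a -> (simplex a)° !=set0.
Proof.
move=> aff; pose M : 'M[R]_d := \matrix_i (a (lift ord0 i) - a ord0).
have uM : M \in unitmx.
  rewrite -row_free_unit -kermx_eq0; apply/eqP/row_matrixP => k; rewrite row0.
  set y := row k (kermx M).
  have yM : y *m M = 0 by apply/sub_kermxP; exact: row_sub.
  (* A vector y in the kernel of the edge matrix becomes an affine dependence of the vertices once
     vertex 0 balances the sum of the weights. *)
  pose l i := if unlift ord0 i is Some j then y 0 j else - \sum_j y 0 j.
  have ll j : l (lift ord0 j) = y 0 j by rewrite /l liftK.
  have l0 : l ord0 = - \sum_j y 0 j by rewrite /l unlift_none.
  have l_eq0 : forall i, l i = 0.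
    apply: aff; rewrite big_ord_recl l0;
      under [X in _ + X]eq_bigr do rewrite ll.
      by rewrite addNr.
    rewrite -[RHS]yM mulmx_sum_row.
    under [RHS]eq_bigr do rewrite rowK scalerBr.
    by rewrite sumrB -scaler_suml scaleNr addrC.
  by apply/rowP => j; rewrite -ll l_eq0 mxE.
(* These are the barycentric coordinates of x, except that of vertex 0, which is one minus their
   sum. *)
pose phi (x : E) := (x - a ord0) *m invmx M.
have phiK x : x = a ord0 + phi x *m M by rewrite mulmxKV// addrC subrK.
have cphi i : continuous (fun x => phi x 0 i).
  have -> : (fun x => phi x 0 i) =
      (fun x => \sum_j (x 0 j - a ord0 0 j) * invmx M j i).
    by apply/funext => x; rewrite mxE; apply: eq_bigr => j _; rewrite !mxE.
  apply: (@continuous_bigsum R _ R^o) => j x.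
  apply: (@continuousM R E (fun y => y 0 j - a ord0 0 j) (cst _));
    last exact: cst_continuous.
  apply: (@continuousB R R^o E (fun y => y 0 j) (cst _)).
    exact: coord_continuous.
  exact: cst_continuous.
(* The interior point is the barycentre: its d remaining coordinates are positive and sum to d/(d+1)
   < 1, and these strict conditions are open. *)
pose c : R := d.+1%:R^-1.
have c0 : 0 < c by rewrite invr_gt0.
exists (a ord0 + (\row_(i < d) c) *m M).
have phi0 i : phi (a ord0 + (\row_(i < d) c) *m M) 0 i = c.
  by rewrite /phi addrC addKr mulmxK// mxE.
have cs : continuous (fun x => \sum_i phi x 0 i : R^o).
  exact: (@continuous_bigsum R _ R^o).
set z := _ + _ in phi0 *.
have z0 : \forall x \near z, forall i, 0 < phi x 0 i.
  have z0 i : nbhs z [set x | 0 < phi x 0 i].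
    by apply: (cvgr_gt _ (cphi i z)); rewrite phi0.
  exact: (@filter_forall _ _ (fun i => [set x | 0 < phi x 0 i]) (nbhs z) _ z0).
have z1 : \forall x \near z, \sum_i phi x 0 i < 1.
  apply: (cvgr_lt _ (cs z)); under eq_bigr do rewrite phi0.
  by rewrite sumr_const card_ord -mulr_natl ltr_pdivrMr// mul1r ltr_nat.
suff sub : [set x | forall i, 0 < phi x 0 i] `&` [set x | \sum_i phi x 0 i < 1]
    `<=` simplex a by exact: filterS sub (filterI z0 z1).
move=> x [x0 x1].
pose l i := if unlift ord0 i is Some j then phi x 0 j else 1 - \sum_j phi x 0 j.
have ll j : l (lift ord0 j) = phi x 0 j by rewrite /l liftK.
have l0 : l ord0 = 1 - \sum_j phi x 0 j by rewrite /l unlift_none.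
exists l; split.
- by move=> i; have [j ->|->] := unliftP ord0 i; rewrite ?ll ?l0 ?subr_ge0 ltW.
- by rewrite big_ord_recl l0; under [X in _ + X]eq_bigr do rewrite ll;
  rewrite subrK.
rewrite [LHS]phiK big_ord_recl l0 mulmx_sum_row.
under [X in _ = _ + X]eq_bigr do rewrite ll.
under [X in _ + X = _]eq_bigr do rewrite rowK scalerBr.
by rewrite sumrB -scaler_suml scalerBl scale1r addrA addrAC.
Qed.

End simplex_theory.

(** * Finiteness of the surface measure *)

Section surface.
Context {R : realType} {d : nat}.
Local Notation E := 'rV[R]_d.

Lemma enorm1_coord (nu : E) i : enorm nu = 1 -> `|nu 0 i| <= 1.
Proof.
move=> nu1; rewrite -nu1 /enorm -sqrtr_sqr ler_sqrt; last first.
  by apply: sumr_ge0 => j _; rewrite -expr2 sqr_ge0.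
rewrite /dot (bigD1 i)//= -expr2 lerDl.
by apply: sumr_ge0 => j _; rewrite -expr2 sqr_ge0.
Qed.

(** A point of the prism over A differs from its projection by t nu with 0 <= t <= 1 and coordinates
    of nu at most 1 in size, so a box larger by 1 contains the prism. *)
Lemma bounded_hyperplane_measure (p : E * R) (A : set E) :
  enorm p.1 = 1 -> measurable A -> bounded_set A ->
  (hyperplane_measure p A < +oo)%E.
Proof.
move=> nu1 mA /bounded_rV_box[M M0 AM].
rewrite /hyperplane_measure /= /image_measure /pushforward /mrestr /=.
have mP : measurable (hyperplane_proj p @^-1` A).
  rewrite -[X in measurable X]setTI.
  exact: (@measurable_funPT _ _ _ _ (hyperplane_proj p)).
apply: (@le_lt_trans _ _ (lebesgue_rV R d (rV_box 0 (M + 1)))).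
  apply: le_measure; rewrite ?inE.
  - by apply: measurableI => //; exact: measurable_slab.
  - exact: measurable_rV_box.
  move=> x [/AM xM /andP[x0 x1]] i; have := xM i.
  rewrite /hyperplane_proj !mxE !subr0 => xi.
  have := enorm1_coord i nu1; rewrite !ler_norml in xi *.
  move: xi; set t := dot _ _ - _ in x0 x1 *.
  move=> /andP[? ?] /andP[? ?]; apply/andP; split; nra.
by rewrite lebesgue_rV_box ?ltry// addr_ge0// ltW.
Qed.

Lemma bounded_surface_measure (H : seq (E * R)) (A : set E) :
  {in H, forall p, enorm p.1 = 1} -> measurable A -> bounded_set A ->
  (surface_measure H A < +oo)%E.
Proof.
move=> H1 mA bA; rewrite /surface_measure /= /msum.
apply: lte_sum_pinfty => i _; apply: bounded_hyperplane_measure => //.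
by apply: H1; exact: mem_nth.
Qed.

End surface.

(** * Discrete gradient and normal derivative of piecewise polynomials *)

Section mesh_linearity.
Context {R : realType} {d : nat}.
Local Notation E := 'rV[R]_d.
Variables (T : mesh R d).
Hypothesis nondeg : forall i, affinely_independent (elt T i).

(** Outside this class [local_poly] may fall back to its default 0, which destroys linearity. *)
Definition piecewise_poly (v : E -> R) := forall i, exists p : mpoly.mpoly d R,
  forall x, simplex (elt T i) x -> v x = poly_eval p x.

Lemma poly_evalD (p q : mpoly.mpoly d R) x :
  poly_eval (p + q) x = poly_eval p x + poly_eval q x.
Proof. exact: mpoly.mevalD. Qed.

Lemma poly_evalZ c (p : mpoly.mpoly d R) x :
  poly_eval (c *: p) x = c * poly_eval p x.
Proof. exact: mpoly.mevalZ. Qed.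

Lemma poly_eval_simplex_inj i (p q : mpoly.mpoly d R) :
  (forall x, simplex (elt T i) x -> poly_eval p x = poly_eval q x) -> p = q.
Proof.
move=> pq; apply/eqP; rewrite -subr_eq0; apply/eqP.
apply: (mpoly_eq0_open (U := (simplex (elt T i))°)).
- exact: open_interior.
- exact: simplex_interior.
move=> x /interior_subset/pq pqx; rewrite -scaleN1r poly_evalD poly_evalZ pqx.
by rewrite mulN1r subrr.
Qed.

(** [xget] returns some witness, and injectivity of evaluation on the simplex leaves only one. *)
Lemma local_polyE v (i : 'I_(nelt T)) p :
  (forall x, simplex (elt T i) x -> v x = poly_eval p x) -> local_poly v i = p.
Proof.
move=> vp; rewrite /local_poly; case: xgetP => [q _ vq|/(_ p)//].
by apply: (@poly_eval_simplex_inj i) => x ix; rewrite -vq// vp.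
Qed.

Lemma local_polyP v (i : 'I_(nelt T)) x : piecewise_poly v -> simplex (elt T i)
  x ->
  v x = poly_eval (local_poly v i) x.
Proof. by move=> /(_ i)[p vp]; rewrite (local_polyE vp) => /vp. Qed.

Lemma local_poly_lin a b v w (i : 'I_(nelt T)) : piecewise_poly v ->
  piecewise_poly w ->
  local_poly (fun x => a * v x + b * w x) i =
  a *: local_poly v i + b *: local_poly w i.
Proof.
move=> pv pw; apply: local_polyE => x ix.
by rewrite poly_evalD !poly_evalZ -!local_polyP.
Qed.

Lemma poly_grad_lin a b (p q : mpoly.mpoly d R) x :
  poly_grad (a *: p + b *: q) x = a *: poly_grad p x + b *: poly_grad q x.
Proof.
apply/rowP => i; rewrite !mxE mpoly.mderivD !mpoly.mderivZ.
by rewrite poly_evalD !poly_evalZ.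
Qed.

(** The element picked at x does not depend on the function, so linearity holds at every point,
    including those shared by several elements. *)
Lemma gradh_lin a b v w : piecewise_poly v -> piecewise_poly w ->
  gradh T (fun x => a * v x + b * w x) =
  fun x => a *: gradh T v x + b *: gradh T w x.
Proof.
move=> pv pw; apply/funext => x; rewrite /gradh; case: pickP => [i _|_].
  by rewrite local_poly_lin// poly_grad_lin.
by rewrite !scaler0 addr0.
Qed.

Lemma dotDl (x y z : E) : dot (x + y) z = dot x z + dot y z.
Proof.
by rewrite /dot -big_split; apply: eq_bigr => i _; rewrite mxE mulrDl.
Qed.

Lemma dotZl a (x y : E) : dot (a *: x) y = a * dot x y.
Proof.
by rewrite /dot mulr_sumr; apply: eq_bigr => i _; rewrite mxE mulrA.
Qed.

Lemma sigma_n_lin GammaC a b v w : piecewise_poly v -> piecewise_poly w ->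
  sigma_n T GammaC (fun x => a * v x + b * w x) =
  fun x => a * sigma_n T GammaC v x + b * sigma_n T GammaC w x.
Proof.
move=> pv pw; apply/funext => x; rewrite /sigma_n; case: pickP => [i _|_].
  by rewrite local_poly_lin// poly_grad_lin dotDl !dotZl.
by rewrite !mulr0 addr0.
Qed.

Lemma continuous_poly_grad (p : mpoly.mpoly d R) i :
  continuous (fun x => poly_grad p x 0 i).
Proof.
rewrite (_ : (fun x => _) = poly_eval (mpoly.mderiv i p)).
  exact: continuous_poly_eval.
by apply/funext => x; rewrite mxE.
Qed.

Lemma measurable_sigma_n GammaC v :
  measurable_fun setT (sigma_n T GammaC v : E -> measurableTypeR R).
Proof.
pose P ij := [set x | face (elt T ij.1) ij.2 `<=` closure GammaC /\
                      face (elt T ij.1) ij.2 x].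
apply: (measurable_pick (P := P)) => [ij|ij].
  (* The inclusion does not involve x, so the selection set is either the whole face or empty. *)
  have [sub|nsub] := pselect (face (elt T ij.1) ij.2 `<=` closure GammaC).
    rewrite (_ : P ij = face (elt T ij.1) ij.2); last first.
      by apply/seteqP; split => x; [case|].
    by apply: compact_measurable_rV; exact: compact_face.
  by rewrite (_ : P ij = set0)//; apply/seteqP; split => x // [].
apply: measurable_sum => i; apply: measurable_funM => //.
apply: within_continuous_measurable_rV => //; apply: continuous_subspaceT.
exact: continuous_poly_grad.
Qed.

(** Each value is 0 or that of one of finitely many continuous functions; the sum of their bounds on
    K serves for all. *)
Lemma sigma_n_bounded GammaC v (K : set E) : compact K ->
  exists M, forall x, K x -> `|sigma_n T GammaC v x| <= M.
Proof.
move=> cK.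
pose F (ij : 'I_(nelt T) * 'I_d.+1) x :=
  dot (poly_grad (local_poly v ij.1) x) (outward_normal (elt T ij.1) ij.2).
have FM ij : exists M, forall x, K x -> `|F ij x| <= M.
  have cF : {within K, continuous (F ij : E -> R^o)}.
    apply: continuous_subspaceT; apply: (@continuous_bigsum R _ R^o) => i x.
    apply: (@continuousM R E _ (cst _)); last exact: cst_continuous.
    exact: continuous_poly_grad.
  have [M [_ FM]] := compact_bounded (continuous_compact cF cK).
  exists (M + 1) => x Kx; apply: (FM (M + 1)); first by rewrite ltrDl.
  by exists x.
have /choice[M MF] := FM.
exists (\sum_ij `|M ij|) => x Kx; rewrite /sigma_n; case: pickP => [ij _|_].
  rewrite (bigD1 ij)//= (le_trans (MF ij x Kx))// (le_trans (ler_norm _))//.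
  by rewrite lerDl sumr_ge0.
by rewrite normr0 sumr_ge0.
Qed.

End mesh_linearity.

(** * Bounded functions on sets of finite measure *)

Section compact_L2.
Context {R : realType} {d : nat}.
Local Notation E := 'rV[R]_d.

Lemma L2_bounded (mu : {measure set E -> \bar R}) (D : set E) (f : E -> R) (M :
  R) :
  measurable D -> (mu D < +oo)%E ->
  measurable_fun D (f : E -> measurableTypeR R) ->
  (forall x, D x -> `|f x| <= M) -> L2 mu D f.
Proof.
move=> mD Doo mf fM; apply: (L2_dominated mD mf _ (L2_cst mD M Doo)) => x Dx.
exact: le_trans (fM x Dx) (ler_norm _).
Qed.

Lemma within_continuous_bounded (K : set E) (f : E -> R) : compact K ->
  {within K, continuous f} -> exists M, forall x, K x -> `|f x| <= M.
Proof.
move=> cK cf; have cf' : {within K, continuous (f : E -> R^o)} by [].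
have [M [_ FM]] := compact_bounded (continuous_compact cf' cK).
exists (M + 1) => x Kx; apply: (FM (M + 1)); first by rewrite ltrDl.
by exists x.
Qed.

Lemma L2_within_continuous (mu : {measure set E -> \bar R}) (D K : set E)
    (f : E -> R) : measurable D -> (mu D < +oo)%E -> D `<=` K -> compact K ->
  {within K, continuous f} -> L2 mu D f.
Proof.
move=> mD Doo DK cK cf; have [M fM] := within_continuous_bounded cK cf.
apply: (@L2_bounded _ _ _ M) => // [|x /DK]; last exact: fM.
apply: (measurable_funS _ DK); first exact: compact_measurable_rV.
by apply: within_continuous_measurable_rV => //; exact: compact_measurable_rV.
Qed.

Lemma rV_box0P (x : E) (M : R) : 0 <= M -> rV_box 0 M x <-> `|x| <= M.
Proof.
move=> M0; have -> : `|x| = \big[Num.max/0]_ij `|x ij.1 ij.2|.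
  by rewrite -mx_normrE.
split=> [xM|/bigmax_leP[_ xM] i].
  apply/bigmax_leP; split => // -[i j] _ /=.
  by have := xM j; rewrite mxE subr0 (ord1 i).
by have := xM (0, i) isT; rewrite mxE subr0.
Qed.

Lemma bounded_compact_closure (A : set E) : bounded_set A -> compact (closure
  A).
Proof.
move=> bA; apply: bounded_closed_compact; last exact: closed_closure.
have [M M0 AM] := bounded_rV_box bA.
have cB : closed (rV_box (0 : E) M).
  rewrite (_ : rV_box _ _ = closed_ball (0 : E) M).
    exact: closed_ball_closed.
  rewrite closed_ballE// /closed_ball_; apply/seteqP; split => x /=;
    by rewrite sub0r normrN => /(rV_box0P x (ltW M0)).
have AB : closure A `<=` rV_box 0 M by rewrite closureE => x; apply.
exists M; split; first exact: num_real.
move=> M' MM' x /AB /(rV_box0P x (ltW M0)) /le_trans; apply; exact: ltW.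
Qed.

End compact_L2.

(** * Linear combinations of smooth functions *)

Section smooth_linear.
Context {R : realType} {d : nat}.
Local Notation E := 'rV[R]_d.
Implicit Types f g : E -> R.

Lemma derivable_lin a b f g x (v : E) : derivable f x v -> derivable g x v ->
  derivable (fun y => a * f y + b * g y) x v.
Proof.
move=> df dg.
exact: (derivableD (derivableM (derivable_cst a x v) df)
                   (derivableM (derivable_cst b x v) dg)).
Qed.

Lemma pderiv_lin i a b f g :
  (forall x, derivable f x (delta_mx 0 i)) ->
  (forall x, derivable g x (delta_mx 0 i)) ->
  pderiv i (fun x => a * f x + b * g x) =
  fun x => a * pderiv i f x + b * pderiv i g x.
Proof.
move=> df dg; apply/funext => x; rewrite /pderiv.
rewrite (@deriveD _ _ _ (a \*: (f : E -> R^o)) (b \*: (g : E -> R^o)));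
  [|exact: derivableZ..].
by rewrite !deriveZ.
Qed.

Lemma foldr_pderiv_lin a b f g s : smooth f -> smooth g ->
  foldr pderiv (fun x => a * f x + b * g x) s =
  fun x => a * foldr pderiv f s x + b * foldr pderiv g s x.
Proof.
move=> sf sg; elim: s => //= i s ->; rewrite pderiv_lin// => x.
  by have [_] := sf s.
by have [_] := sg s.
Qed.

(** Traces are limits along smooth functions, so combining two approximating sequences must not
    leave this class. *)
Lemma smooth_lin a b f g : smooth f -> smooth g ->
  smooth (fun x => a * f x + b * g x).
Proof.
move=> sf sg s; rewrite foldr_pderiv_lin//.
have [cf df] := sf s; have [cg dg] := sg s; split.
  move=> x; apply: (@continuousD R R^o E (fun x => a * foldr pderiv f s x)).
    exact: (@continuousM R E (cst a) _ x (@cst_continuous _ _ _ _) (cf x)).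
  exact: (@continuousM R E (cst b) _ x (@cst_continuous _ _ _ _) (cg x)).
by move=> i x; apply: derivable_lin.
Qed.

Lemma foldr_pderiv0 s : foldr pderiv (fun _ : E => 0 : R) s = fun=> 0.
Proof.
elim: s => //= i s ->; apply/funext => x.
exact: (@derive_cst _ E R^o).
Qed.

Lemma smooth0 : smooth (fun _ : E => 0 : R).
Proof.
move=> s; rewrite foldr_pderiv0; split=> [|i x]; first exact: cst_continuous.
exact: (@derivable_cst _ E R^o).
Qed.

End smooth_linear.

(** * V and V_h are closed under linear combinations *)

Section H1_linear.
Context {R : realType} {d : nat}.
Local Notation E := 'rV[R]_d.
Variables (H : seq (E * R)) (Omega : set E).
Hypothesis domain : polyhedral_lipschitz_domain H Omega.
Local Notation lambda := (lebesgue_rV R d).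
Local Notation sigma := (surface_measure H).

Lemma measurable_domain : measurable Omega.
Proof. exact: open_measurable_rV (domain_open domain). Qed.

Lemma compact_closure_domain : compact (closure Omega).
Proof. exact: bounded_compact_closure (domain_bounded domain). Qed.

Lemma lebesgue_domain : (lambda Omega < +oo)%E.
Proof. exact: bounded_lebesgue_rV measurable_domain (domain_bounded domain).
  Qed.

Lemma boundary_sub_closure : boundary Omega `<=` closure Omega.
Proof. by move=> x []. Qed.

Lemma measurable_boundary : measurable (boundary Omega).
Proof.
apply: measurableD; first exact: (closed_measurable_rV (@closed_closure _ _)).
exact: (open_measurable_rV (open_interior _)).
Qed.

Lemma surface_boundary : (sigma (boundary Omega) < +oo)%E.
Proof.
apply: bounded_surface_measure measurable_boundary _ => [|].
  exact: planes_unit domain.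
apply: sub_boundedr _ (compact_bounded compact_closure_domain) => P.
by move=> KP x /boundary_sub_closure/KP.
Qed.

Lemma L2_continuous_domain f : continuous f -> L2 lambda Omega f.
Proof.
move=> cf; apply: L2_within_continuous compact_closure_domain _.
- exact: measurable_domain.
- exact: lebesgue_domain.
- exact: subset_closure.
- exact: continuous_subspaceT.
Qed.

Lemma measurable_continuous (D : set E) (f : E -> R) : measurable D ->
  continuous f -> measurable_fun D (f : E -> measurableTypeR R).
Proof.
move=> mD cf; apply: within_continuous_measurable_rV => //.
exact: continuous_subspaceT.
Qed.

Lemma lin_coord a b (G K : E -> E) i :
  (fun x => (a *: G x + b *: K x) 0 i) =
  (fun x => a * G x 0 i + b * K x 0 i).
Proof. by apply/funext => x; rewrite !mxE. Qed.

Lemma weak_gradient_lin a b v w (G K : E -> E) : H1 Omega v G -> H1 Omega w K ->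
  weak_gradient Omega (fun x => a * v x + b * w x)
                      (fun x => a *: G x + b *: K x).
Proof.
move=> Hv Hw phi tphi i; have [sphi _] := tphi.
(* Splitting the integrals requires the test function and its derivative in L2; both are continuous,
   and the domain is bounded. *)
have Lphi : L2 lambda Omega phi.
  by apply: L2_continuous_domain; have [] := sphi [::].
have Ldphi : L2 lambda Omega (pderiv i phi).
  by apply: L2_continuous_domain; have [] := sphi [:: i].
have mO := measurable_domain.
rewrite L2_inner_lin//; [|exact: H1_val Hv|exact: H1_val Hw].
rewrite (H1_weak Hv)// (H1_weak Hw)//.
rewrite lin_coord.
rewrite (L2_inner_lin mO a b (H1_grad Hv i) (H1_grad Hw i) Lphi).
by rewrite !mulrN opprD.
Qed.

Lemma H1_lin a b v w (G K : E -> E) : H1 Omega v G -> H1 Omega w K ->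
  H1 Omega (fun x => a * v x + b * w x) (fun x => a *: G x + b *: K x).
Proof.
move=> Hv Hw; have mO := measurable_domain; split.
- exact: (L2_lin mO a b (H1_val Hv) (H1_val Hw)).
- move=> i; rewrite lin_coord.
  exact: (L2_lin mO a b (H1_grad Hv i) (H1_grad Hw i)).
- exact: weak_gradient_lin.
Qed.

Lemma trace_lin a b v w (G K : E -> E) tau ups :
  H1 Omega v G -> H1 Omega w K ->
  trace H Omega v G tau -> trace H Omega w K ups ->
  trace H Omega (fun x => a * v x + b * w x) (fun x => a *: G x + b *: K x)
    (fun x => a * tau x + b * ups x).
Proof.
move=> Hv Hw [Ltau [u [su uv uG utau]]] [Lups [u' [su' u'w u'K u'ups]]].
have mO := measurable_domain; have mB := measurable_boundary.
have cs (f : E -> R) s : smooth f -> continuous (foldr pderiv f s) by move=>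
  /(_ s)[].
split; first exact: (L2_lin mB a b Ltau Lups).
exists (fun n x => a * u n x + b * u' n x); split.
- by move=> n; apply: smooth_lin.
- apply: (L2_cvg_lin mO a b _ _ _ _ uv u'w).
  + by move=> n; apply: (measurable_continuous mO);
    exact: (cs (u n) [::] (su n)).
  + by move=> n; apply: (measurable_continuous mO);
    exact: (cs (u' n) [::] (su' n)).
  + by have [] := H1_val Hv.
  + by have [] := H1_val Hw.
- move=> i.
  rewrite (_ : (fun n => _) = fun n x =>
    a * pderiv i (u n) x + b * pderiv i (u' n) x); last first.
    by apply/funext => n; exact: (@foldr_pderiv_lin _ _ a b (u n) (u' n) [::
      i]).
  rewrite lin_coord.
  apply: (L2_cvg_lin mO a b _ _ _ _ (uG i) (u'K i)).
  + by move=> n; apply: (measurable_continuous mO);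
    exact: (cs (u n) [:: i] (su n)).
  + by move=> n; apply: (measurable_continuous mO);
    exact: (cs (u' n) [:: i] (su' n)).
  + by have [] := H1_grad Hv i.
  + by have [] := H1_grad Hw i.
- apply: (L2_cvg_lin mB a b _ _ _ _ utau u'ups).
  + by move=> n; apply: (measurable_continuous mB);
    exact: (cs (u n) [::] (su n)).
  + by move=> n; apply: (measurable_continuous mB);
    exact: (cs (u' n) [::] (su' n)).
  + by have [] := Ltau.
  + by have [] := Lups.
Qed.

Lemma in_V_lin GammaD a b v w (G K : E -> E) :
  in_V H Omega GammaD v G -> in_V H Omega GammaD w K ->
  in_V H Omega GammaD (fun x => a * v x + b * w x)
    (fun x => a *: G x + b *: K x).
Proof.
move=> [Hv [tau Ttau tau0]] [Hw [ups Tups ups0]]; split; first exact: H1_lin.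
exists (fun x => a * tau x + b * ups x); first exact: trace_lin.
by apply: filterS2 tau0 ups0 => x + + Dx => -> // -> //; rewrite !mulr0 addr0.
Qed.

Lemma L2_cst0 (mu : {measure set E -> \bar R}) D :
  measurable D -> L2 mu D (fun=> 0).
Proof. by move=> mD; split => //; under eq_integral do rewrite expr0n;
  rewrite integral0. Qed.

Lemma L2_cvg0 (mu : {measure set E -> \bar R}) D :
  L2_cvg mu D (fun _ _ => 0) (fun=> 0).
Proof.
rewrite /L2_cvg (_ : (fun n => _) = cst 0%E); first exact: cvg_cst.
apply/funext => n; under eq_integral do rewrite subr0 expr0n/=.
by rewrite integral0.
Qed.

Lemma in_V0 GammaD : in_V H Omega GammaD (fun=> 0) (fun=> 0).
Proof.
have mO := measurable_domain.
have e0 i : (fun x : E => (fun=> 0 : E) x 0 i) = (fun=> 0) :> (E -> R).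
  by apply/funext => x; rewrite mxE.
split; first split.
- exact: L2_cst0.
- by move=> i; rewrite e0; exact: L2_cst0.
- move=> phi _ i; rewrite e0 /L2_inner.
  by under eq_Rintegral do rewrite mul0r;
    under [in RHS]eq_Rintegral do rewrite mul0r;
    rewrite /Rintegral integral0 oppr0.
exists (fun=> 0); last by apply: nearW.
split; first exact: (L2_cst0 _ measurable_boundary).
exists (fun _ _ => 0); split => //.
- by move=> _; exact: smooth0.
- exact: L2_cvg0.
- move=> i; rewrite e0 (_ : (fun n => _) = fun _ _ => 0); first exact: L2_cvg0.
  by apply/funext => n; exact: (@foldr_pderiv0 _ _ [:: i]).
- exact: L2_cvg0.
Qed.

Variables (GammaD : set E) (k : nat) (T : mesh R d).
Hypothesis partition : is_partition Omega T.
Let nondeg := elt_nondegenerate partition.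
Local Notation V_h := (Vh H Omega GammaD k T).

Lemma Vh_piecewise_poly v : V_h v -> piecewise_poly T v.
Proof. by move=> [_ _ pv] i; have [p _ vp] := pv i; exists p. Qed.

Lemma Vh_lin a b v w : V_h v -> V_h w -> V_h (fun x => a * v x + b * w x).
Proof.
move=> Vv Vw; have [iv cv pv] := Vv; have [iw cw pw] := Vw; split.
- rewrite gradh_lin//; [exact: in_V_lin|exact: Vh_piecewise_poly..].
- have cl (c : R) (u : E -> R) : {within closure Omega, continuous u} ->
      {within closure Omega, continuous (fun x => c * u x)}.
    move=> cu x; exact: (@continuousM R (subspace (closure Omega)) (cst c) u x
      (@cst_continuous _ _ _ _) (cu x)).
  move=> x; exact: (@continuousD R R^o (subspace (closure Omega))
    _ _ x (cl a v cv x) (cl b w cw x)).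
move=> i; have [p sp vp] := pv i; have [q sq wq] := pw i.
exists (a *: p + b *: q).
  rewrite (leq_trans (mpoly.msizeD_le _ _))// geq_max.
  by rewrite !(leq_trans (mpoly.msizeZ_le _ _)).
by move=> x ix; rewrite poly_evalD !poly_evalZ vp// wq.
Qed.

Lemma local_poly0 (i : 'I_(nelt T)) : local_poly (fun=> 0) i = 0.
Proof. by apply: (local_polyE nondeg) => x _;
  rewrite /poly_eval mpoly.meval0. Qed.

Lemma gradh0 : gradh T (fun=> 0) = fun=> 0.
Proof.
apply/funext => x; rewrite /gradh; case: pickP => // i _.
apply/rowP => j; rewrite !mxE (_ : local_poly _ i = 0) ?local_poly0//.
by rewrite mpoly.mderiv0 /poly_eval mpoly.meval0.
Qed.

Lemma Vh0 : V_h (fun=> 0).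
Proof.
split; first by rewrite gradh0; exact: in_V0.
  by move=> x; exact: cst_continuous.
move=> i; exists 0; first by rewrite mpoly.msize0.
by move=> x _; rewrite /poly_eval mpoly.meval0.
Qed.

End H1_linear.

(* The library has matrices both complete and normed, but not their join. *)
HB.instance Definition _ (R : realType) n :=
  Uniform_isComplete.Build 'rV[R]_n (@cauchy_cvg 'rV[R]_n).

(** * Zeros of strongly monotone Lipschitz maps on R^n *)

Section finite_dimension.
Context {R : realType}.

Lemma rV_norm_coord n (x : 'rV[R]_n) i : `|x 0 i| <= `|x|.
Proof.
by have /(rV_box0P x (normr_ge0 x))/(_ i) := lexx `|x|; rewrite mxE subr0.
Qed.

Lemma dot_ge0 n (x : 'rV[R]_n) : 0 <= dot x x.
Proof. by apply: sumr_ge0 => i _; rewrite -expr2 sqr_ge0. Qed.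

Lemma norm_le_dot n (x : 'rV[R]_n) : `|x| ^+ 2 <= dot x x.
Proof.
have sx : 0 <= Num.sqrt (dot x x) by exact: sqrtr_ge0.
rewrite -[leRHS]sqr_sqrtr ?dot_ge0// ler_sqr ?nnegrE//.
apply/(rV_box0P x sx) => i; rewrite mxE subr0 -sqrtr_sqr ler_sqrt ?dot_ge0//.
rewrite /dot (bigD1 i)//= -expr2 lerDl.
by apply: sumr_ge0 => j _; rewrite -expr2 sqr_ge0.
Qed.

Lemma dot_le_norm n (x : 'rV[R]_n) : dot x x <= n%:R * `|x| ^+ 2.
Proof.
rewrite -[n in n%:R]card_ord mulr_natl -sumr_const; apply: ler_sum => i _.
by rewrite -expr2 -real_normK ?num_real// ler_sqr ?nnegrE// rV_norm_coord.
Qed.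

(* The map [x |-> x - t F x] contracts the Euclidean norm, hence an iterate of
   it contracts the library's sup norm. *)
Lemma strongly_monotone_zero n (F : 'rV[R]_n -> 'rV[R]_n) (alpha K : R) :
  0 < alpha ->
  (forall x y, alpha * dot (x - y) (x - y) <= dot (F x - F y) (x - y)) ->
  (forall x y, `|F x - F y| <= K * `|x - y|) ->
  exists x, F x = 0.
Proof.
move=> alpha0 mono lip.
(* n K^2 bounds the squared Lipschitz constant of F in the Euclidean norm, n being the price of
   passing from the sup norm. The other terms secure 0 < M and alpha^2 <= M. *)
pose M := n%:R * K ^+ 2 + alpha ^+ 2 + 1.
have nK0 : 0 <= n%:R * K ^+ 2 by rewrite mulr_ge0// sqr_ge0.
have a20 : 0 < alpha ^+ 2 by rewrite exprn_gt0.
have M0 : 0 < M by rewrite /M; lra.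
(* This t minimises 1 - 2 t alpha + t^2 M, and the minimum is the factor q below. *)
pose t := alpha / M; pose G x := x - t *: F x.
pose q := 1 - alpha ^+ 2 / M.
have q0 : 0 <= q by rewrite subr_ge0 ler_pdivrMr// mul1r /M; lra.
have q1 : q < 1 by rewrite ltrBlDr ltrDl divr_gt0.
have dG x y : dot (G x - G y) (G x - G y) <= q * dot (x - y) (x - y).
  have -> : G x - G y = (x - y) - t *: (F x - F y).
    by rewrite /G scalerBr opprB opprD opprK [RHS]addrACA addrA addrAC -!addrA
      [_ - y]addrC.
  have := mono x y; have : dot (F x - F y) (F x - F y) <= M * dot (x - y) (x -
    y).
    apply: le_trans (dot_le_norm _) _.
    apply: (@le_trans _ _ (n%:R * K ^+ 2 * dot (x - y) (x - y))); last first.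
      by rewrite ler_wpM2r ?dot_ge0// /M; lra.
    rewrite -mulrA ler_wpM2l//; apply: (@le_trans _ _ ((K * `|x - y|) ^+ 2)).
      by rewrite ler_sqr ?nnegrE// (le_trans _ (lip x y)).
    by rewrite exprMn ler_wpM2l ?sqr_ge0// norm_le_dot.
  move: (x - y) (F x - F y) => u w ww uw.
  have -> : dot (u - t *: w) (u - t *: w) =
      dot u u - 2 * t * dot w u + t ^+ 2 * dot w w.
    rewrite /dot !mulr_sumr -sumrB -big_split /=; apply: eq_bigr => i _.
    by rewrite !mxE; ring.
  have t0 : 0 < t by rewrite divr_gt0.
  have -> : q = 1 - 2 * t * alpha + t ^+ 2 * M.
    by rewrite /q /t; field; rewrite lt0r_neq0.
  have H1 : 0 <= t * (dot w u - alpha * dot u u).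
    by rewrite mulr_ge0 ?(ltW t0)// subr_ge0.
  have H2 : 0 <= t ^+ 2 * (M * dot u u - dot w w).
    by rewrite mulr_ge0 ?sqr_ge0// subr_ge0.
  lra.
have dGm m x y : dot (iter m G x - iter m G y) (iter m G x - iter m G y) <=
    q ^+ m * dot (x - y) (x - y).
  elim: m => [|m IHm] /=; first by rewrite expr0 mul1r.
  by rewrite (le_trans (dG _ _))// exprS -mulrA ler_wpM2l.
(* The squared Euclidean norm is at most n times the squared sup norm; once q^m absorbs n, the m-th
   iterate halves sup-norm distances. *)
have [m qm] : exists m, q ^+ m * n%:R <= (1 / 2) ^+ 2.
  have : (q ^+ m * n%:R @[m --> \oo] --> (0 : R)).
    rewrite -[X in _ --> X](mul0r n%:R); apply: cvgMl.
    by apply: cvg_expr; rewrite ger0_norm.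
  move=> /cvgr_lt/(_ ((1 / 2) ^+ 2)); rewrite exprn_gt0// => /(_ isT)[m _ mq].
  by exists m; rewrite ltW//; exact: mq (leqnn m).
have iterG x y : `|iter m G x - iter m G y| <= 1 / 2 * `|x - y|.
  rewrite -ler_sqr ?nnegrE// ?mulr_ge0// (le_trans (norm_le_dot _))//.
  rewrite (le_trans (dGm m x y))// exprMn.
  apply: le_trans (ler_wpM2l _ (dot_le_norm _)) _; first exact: exprn_ge0.
  by rewrite mulrA ler_wpM2r ?sqr_ge0.
have half0 : 0 <= (1 / 2 : R) by [].
have homo : {homo iter m G : x / [set: 'rV[R]_n] x} by [].
have ctr : is_contraction (mkfun_fun homo).
  by exists (NngNum half0); split => [|[x y] _] /=; [lra|exact: iterG].
have [p _ /= pG] := banach_fixed_point ctr closedT (ex_intro _ 0 I).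
(* G p is also fixed by the iterate, so the distance from G p to p is at most half of itself. *)
have Gp : G p = p.
  have {}pG : iter m G p = p by [].
  have := iterG (G p) p; rewrite -iterSr iterS pG => GpG.
  by apply/eqP; rewrite -subr_eq0 -normr_le0; lra.
exists p; move: Gp; rewrite /G => /eqP; rewrite -subr_eq0 addrAC subrr add0r.
rewrite oppr_eq0 scaler_eq0 => /orP[/eqP t0|/eqP//].
by move: t0; rewrite /t => /eqP; rewrite mulf_eq0 invr_eq0 !gt_eqF.
Qed.

End finite_dimension.

(** * Linearity relative to a subset of a module *)

Section linear_on.
Context {R : realType} {X Y : lmodType R}.
Variable S : set X.

(** Linearity is relative to a set because coefficients and discrete derivatives are linear on V_h
    but not on the module of all functions. *)
Definition lin_closed := S 0 /\
  forall a b u v, S u -> S v -> S (a *: u + b *: v).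

Definition lin_on (f : X -> Y) := forall a b u v, S u -> S v ->
  f (a *: u + b *: v) = a *: f u + b *: f v.

Hypothesis Slin : lin_closed.

Lemma lin_on0 f : lin_on f -> f 0 = 0.
Proof.
move=> fl; have [S0 _] := Slin.
by have := fl 0 0 0 0 S0 S0; rewrite !scale0r !addr0.
Qed.

Lemma lin_closedB u v : S u -> S v -> S (u - v).
Proof.
move=> Su Sv; have [_ Sl] := Slin.
by have := Sl 1 (-1) u v Su Sv; rewrite scale1r scaleN1r.
Qed.

Lemma lin_onB f u v : lin_on f -> S u -> S v -> f (u - v) = f u - f v.
Proof.
move=> fl Su Sv.
by have := fl 1 (-1) u v Su Sv; rewrite !scale1r !scaleN1r.
Qed.

Lemma lin_closed_sum (I : Type) (r : seq I) (c : I -> R) (b : I -> X) :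
  (forall i, S (b i)) -> S (\sum_(i <- r) c i *: b i).
Proof.
move=> Sb; have [S0 Sl] := Slin.
elim: r => [|i r IHr]; first by rewrite big_nil.
by rewrite big_cons -[X in _ + X]scale1r; exact: Sl.
Qed.

Lemma lin_on_sum f (I : Type) (r : seq I) (c : I -> R) (b : I -> X) :
  lin_on f -> (forall i, S (b i)) ->
  f (\sum_(i <- r) c i *: b i) = \sum_(i <- r) c i *: f (b i).
Proof.
move=> fl Sb.
elim: r => [|i r IHr]; first by rewrite !big_nil lin_on0.
rewrite !big_cons -[X in f (_ + X)]scale1r fl//; last exact: lin_closed_sum.
by rewrite scale1r IHr.
Qed.

End linear_on.

(** * Bases modulo a kernel, and coercivity of positive quadratic forms *)

Section finite_basis.
Context {R : realType}.

(** Take a longest family in S with independent images, whose length is at most N. If some L v were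
    outside the span of the images, prepending v would give a longer family. *)
Lemma finite_basis (X : lmodType R) (S : set X) N (L : X -> 'rV[R]_N) :
  exists n (b : 'I_n -> X), [/\ forall i, S (b i),
    row_free (\matrix_i L (b i)) &
    forall v, S v -> (L v <= \matrix_i L (b i))%MS].
Proof.
pose P n := `[< exists b : 'I_n -> X, (forall i, S (b i)) /\
  row_free (\matrix_i L (b i)) >].
have exP : exists n, P n.
  exists 0%N; apply/asboolP; exists (fun=> 0); split; first by case.
  by rewrite /row_free -leqn0 rank_leq_row.
have ubP n : P n -> (n <= N)%N.
  by move=> /asboolP[b [_ /eqP <-]]; exact: rank_leq_col.
have [n /asboolP[b [Sb fb]] maxn] := ex_maxnP exP ubP.
exists n, b; split => // v Sv; apply: contraT => nvM.
pose b' (i : 'I_n.+1) := if unlift ord0 i is Some j then b j else v.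
suff /maxn : P n.+1 by rewrite ltnn.
apply/asboolP; exists b'; split.
  by move=> i; rewrite /b'; case: unlift.
set M := \matrix_i L (b i) in fb nvM *.
have -> : \matrix_i L (b' i) = col_mx (L v) M.
  apply/matrixP => i k; rewrite !mxE /b'; case: splitP => [l il|j ij].
    by rewrite (_ : i = ord0) ?unlift_none ?(ord1 l)//; apply: val_inj;
      rewrite /= il (ord1 l).
  by rewrite (_ : i = lift ord0 j) ?liftK ?mxE//; exact: val_inj.
have rkE : \rank (col_mx (L v) M) = \rank (L v + M)%MS by rewrite addsmxE.
rewrite /row_free eqn_leq rank_leq_row /= rkE.
rewrite -[n in (n < _)%N](eqP fb); apply: rank_ltmx.
by rewrite ltmxE addsmxSr/= addsmx_sub submx_refl andbT.
Qed.

(** The form attains a positive minimum on the compact sup-norm sphere and is homogeneous of degree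
    2. Dividing this minimum by n + 1 pays for the passage from the sup norm to [dot]. *)
Lemma quadratic_coercive n (W : 'I_n -> 'I_n -> R) :
  (forall c : 'rV[R]_n, c != 0 -> 0 < \sum_i \sum_j c 0 i * c 0 j * W i j) ->
  exists2 alpha, 0 < alpha &
  forall c : 'rV[R]_n, alpha * dot c c <= \sum_i \sum_j c 0 i * c 0 j * W i j.
Proof.
set Q := fun c : 'rV[R]_n => \sum_i \sum_j c 0 i * c 0 j * W i j => posQ.
have Q0 : Q 0 = 0.
  by rewrite /Q big1// => i _; rewrite big1// => j _; rewrite mxE !mul0r.
have QZ r c : Q (r *: c) = r ^+ 2 * Q c.
  rewrite /Q mulr_sumr; apply: eq_bigr => i _; rewrite mulr_sumr.
  by apply: eq_bigr => j _; rewrite !mxE; ring.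
have dot0 : dot (0 : 'rV[R]_n) 0 = 0.
  by rewrite /dot big1// => i _; rewrite mxE mul0r.
(* In dimension 0 the sphere is empty and has no minimum, but any alpha works. *)
have [[c0 c0n0]|all0] := pselect (exists c : 'rV[R]_n, c != 0); last first.
  exists 1 => // c; rewrite -/(Q c).
  have -> : c = 0 by apply/eqP; apply: contra_notT all0 => ?; exists c.
  by rewrite Q0 dot0 mulr0.
pose sphere := [set c : 'rV[R]_n | `|c| = 1].
have normal c : c != 0 -> sphere (`|c|^-1 *: c).
  move=> cn0; rewrite /sphere /= normrZ ger0_norm ?invr_ge0//.
  by rewrite mulVf// normr_eq0.
have cQ : continuous (Q : 'rV[R]_n -> R^o).
  apply: (@continuous_bigsum R _ R^o) => i.
  apply: (@continuous_bigsum R _ R^o) => j c.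
  apply: (@continuousM R _ _ (cst (W i j)) c); last exact: cst_continuous.
  by apply: (@continuousM R _ (fun c : 'rV[R]_n => c 0 i));
    exact: coord_continuous.
have [c1 c1S c1min] : exists2 c, c \in sphere & forall t,
  t \in sphere -> Q c <= Q t.
  apply: EVT_min_rV.
  - by exists (`|c0|^-1 *: c0); exact: normal.
  - apply: bounded_closed_compact.
      exists 1; split => // M M1 c /= ->; exact: ltW.
    rewrite (_ : sphere = (fun c => `|c|) @^-1` [set 1])//.
    apply: closed_comp; last exact: closed_eq.
    by move=> c _; exact: norm_continuous.
  - exact: continuous_subspaceT.
have c1n0 : c1 != 0.
  by apply/eqP => c10; move: c1S; rewrite inE /sphere /= c10 normr0 => /eqP;
    rewrite eq_sym oner_eq0.
have n0 : (0 < n%:R + 1 :> R) by rewrite ltr_wpDl.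
exists (Q c1 / (n%:R + 1)); first by rewrite divr_gt0// posQ.
move=> c; rewrite -/(Q c); have [->|cn0] := eqVneq c 0;
  first by rewrite Q0 dot0 mulr0.
have Qc : Q c1 * `|c| ^+ 2 <= Q c.
  have := c1min _ (mem_set (normal _ cn0)).
  rewrite QZ exprVn mulrC ler_pdivlMr// exprn_gt0// normr_gt0//.
apply: le_trans Qc; rewrite -mulrA ler_wpM2l//; first by rewrite ltW// posQ.
rewrite mulrC ler_pdivrMr// (le_trans (dot_le_norm c))// mulrC ler_wpM2l
  ?sqr_ge0//.
by rewrite lerDl.
Qed.

End finite_basis.

(** * Abstract monotone variational problems *)

Section monotone_problem.
Context {R : realType} {X : lmodType R} {N : nat}.
Variables (S : set X) (L : X -> 'rV[R]_N).
Variables (A : X -> X -> R) (l : X -> R) (q M : X -> X -> R) (c : R).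
Hypothesis Slin : lin_closed S.
Hypothesis Llin : lin_on S L.
Hypothesis Alin : forall u, S u -> lin_on S (A u : X -> R^o).
Hypothesis llin : lin_on S (l : X -> R^o).
Hypothesis qlinl : forall v, S v -> lin_on S (q^~ v : X -> R^o).
Hypothesis qlinr : forall u, S u -> lin_on S (q u : X -> R^o).
Hypothesis q_ge0 : forall u, S u -> 0 <= q u u.
Hypothesis q_eq0 : forall u, S u -> q u u = 0 -> L u = 0.
Hypothesis c_gt0 : 0 < c.
Hypothesis A_mono : forall u v, S u -> S v ->
  c * q (u - v) (u - v) <= A u (u - v) - A v (u - v).
Hypothesis M_sub : forall a b u v w, S u -> S v -> S w ->
  M (a *: u + b *: v) w <= `|a| * M u w + `|b| * M v w.
Hypothesis A_lip : forall u v w, S u -> S v -> S w ->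
  `|A u w - A v w| <= M (u - v) w.
Hypothesis L_eq0 : forall v, S v -> L v = 0 ->
  l v = 0 /\ forall u, S u -> A u v = 0.

(** It suffices to test with finitely many b i: a general v in S differs from a combination of them
    by an element of the kernel of L, on which both sides vanish. As A is nonlinear in its first
    argument, its variation is controlled by M, whose subadditivity takes the place of linearity. *)
Lemma monotone_problem_solvable :
  exists2 u, S u & forall v, S v -> A u v = l v.
Proof.
have [n [b [Sb freeb Lb]]] := finite_basis S L.
pose comb (x : 'rV[R]_n) := \sum_i x 0 i *: b i.
have Scomb x : S (comb x) by exact: lin_closed_sum.
have Lcomb x : L (comb x) = x *m \matrix_i L (b i).
  rewrite /comb (lin_on_sum Slin _ _ Llin)// mulmx_sum_row.
  by apply: eq_bigr => i _; rewrite rowK.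
have combB x y : comb (x - y) = comb x - comb y.
  by rewrite /comb -sumrB; apply: eq_bigr => i _; rewrite !mxE scalerBl.
have Acomb u x : S u -> A u (comb x) = \sum_i x 0 i * A u (b i).
  by move=> Su; exact: (lin_on_sum Slin _ _ (Alin Su)).
have lcomb x : l (comb x) = \sum_i x 0 i * l (b i).
  exact: (lin_on_sum Slin _ _ llin).
have qcomb x : q (comb x) (comb x) =
    \sum_i \sum_j x 0 i * x 0 j * q (b i) (b j).
  rewrite {1}/comb (lin_on_sum Slin _ _ (qlinl (Scomb x)))//.
  apply: eq_bigr => i _; rewrite /comb (lin_on_sum Slin _ _ (qlinr (Sb i)))//.
  by rewrite scaler_sumr; apply: eq_bigr => j _; rewrite scalerA.
(* The Gram matrix of q is positive definite: q = 0 forces L of the combination to vanish, and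
   independence of the images then gives x = 0. *)
have [alpha alpha0 qalpha] : exists2 alpha, 0 < alpha & forall x : 'rV[R]_n,
    alpha * dot x x <= \sum_i \sum_j x 0 i * x 0 j * q (b i) (b j).
  apply: quadratic_coercive => x xn0; rewrite -qcomb lt_neqAle q_ge0// andbT.
  apply: contra xn0 => /eqP/esym/q_eq0 => /(_ (Scomb x)).
  rewrite Lcomb => /eqP; rewrite mulmx_free_eq0//.
have M_comb x j : M (comb x) (b j) <= \sum_i `|x 0 i| * M (b i) (b j).
  rewrite /comb; elim: (index_enum _) => [|i r IHr].
    have [S0 _] := Slin.
    have := M_sub 0 0 S0 S0 (Sb j).
    by rewrite !scale0r addr0 normr0 !mul0r addr0 !big_nil.
  rewrite !big_cons -[X in M (_ + X)]scale1r.
  apply: le_trans (M_sub _ _ (Sb i) (lin_closed_sum Slin _ _ Sb) (Sb j)) _.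
  by rewrite normr1 mul1r lerD2l.
pose F (x : 'rV[R]_n) : 'rV[R]_n := \row_j (A (comb x) (b j) - l (b j)).
(* Absolute values, since M is not assumed nonnegative; the sum over j bounds all coordinates of F
   at once. *)
pose K := \sum_i \sum_j `|M (b i) (b j)|.
have [x Fx0] : exists x, F x = 0.
  apply: (@strongly_monotone_zero _ n F (c * alpha) K); first exact: mulr_gt0.
  - move=> x y.
    have -> : dot (F x - F y) (x - y) =
        A (comb x) (comb x - comb y) - A (comb y) (comb x - comb y).
      rewrite -combB !Acomb// /dot -sumrB; apply: eq_bigr => i _.
      by rewrite !mxE; ring.
    apply: le_trans (A_mono (Scomb x) (Scomb y)).
    by rewrite -combB qcomb -mulrA ler_wpM2l ?(ltW c_gt0).
  - move=> x y; apply/rV_box0P.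
      by rewrite mulr_ge0// sumr_ge0// => i _; rewrite sumr_ge0.
    move=> j; rewrite !mxE subr0.
    have -> : A (comb x) (b j) - l (b j) - (A (comb y) (b j) - l (b j)) =
        A (comb x) (b j) - A (comb y) (b j) by ring.
    apply: le_trans (A_lip (Scomb x) (Scomb y) (Sb j)) _.
    rewrite -combB (le_trans (M_comb _ _))// /K mulr_suml;
      apply: ler_sum => i _.
    apply: (@le_trans _ _ (`|(x - y) 0 i| * `|M (b i) (b j)|)).
      by rewrite ler_wpM2l// ler_norm.
    rewrite mulrC; apply: ler_pM => //; last exact: rV_norm_coord.
    by rewrite (bigD1 j)//= lerDl sumr_ge0.
exists (comb x) => // v Sv.
have [y vy] : exists y, L v = L (comb y).
  by have /submxP[y vy] := Lb v Sv; exists y; rewrite Lcomb.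
have Sz := lin_closedB Slin Sv (Scomb y).
have [lz Az] : l (v - comb y) = 0 /\ forall u, S u -> A u (v - comb y) = 0.
  by apply: L_eq0 => //; rewrite (lin_onB Llin)// vy subrr.
have := Az _ (Scomb x); rewrite (lin_onB (Alin (Scomb x)))// => /subr0_eq ->.
move: lz; rewrite (lin_onB llin)// => /subr0_eq ->.
rewrite Acomb// lcomb; apply: eq_bigr => j _; congr (_ * _).
by apply/eqP; rewrite -subr_eq0; have /rowP/(_ j) := Fx0; rewrite !mxE => ->.
Qed.

End monotone_problem.

(** * The smoothed positive part *)

Section phi_plus_theory.
Context {R : realType} (s : R).
Hypothesis s0 : 0 < s.

(* [(r t - r u) (r t + r u) = (t - u) (t + u) / 4] for [r t = sqrt (t^2/4 + s)],
   and [r t >= |t| / 2]. *)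
Lemma phi_plus_incr (t u : R) : u <= t ->
  0 <= phi_plus s t - phi_plus s u <= t - u.
Proof.
move=> ut; rewrite /phi_plus.
have r0 (x : R) : 0 < x ^+ 2 / 4 + s.
  by rewrite ltr_wpDl// divr_ge0// sqr_ge0.
have rE (x : R) : Num.sqrt (x ^+ 2 / 4 + s) ^+ 2 = x ^+ 2 / 4 + s.
  by rewrite sqr_sqrtr// ltW.
have rx (x : R) : `|x| / 2 <= Num.sqrt (x ^+ 2 / 4 + s).
  rewrite -ler_sqr ?nnegrE ?sqrtr_ge0 ?divr_ge0// rE exprMn real_normK
    ?num_real//.
  by rewrite exprVn -natrX/= lerDl ltW.
have := rE t; have := rE u; have := rx t; have := rx u.
set a := Num.sqrt _; set b := Num.sqrt _ => bu ta bE aE.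
have st : 0 < a + b by rewrite ltr_pwDl// ?sqrtr_gt0// sqrtr_ge0.
have [tn un] : - t / 2 <= b /\ t / 2 <= b.
  by move: ta; have := ler_norm t; have := ler_norm (- t); rewrite normrN;
    split; lra.
have [vn vn'] : - u / 2 <= a /\ u / 2 <= a.
  by move: bu; have := ler_norm u; have := ler_norm (- u); rewrite normrN;
    split; lra.
(* Multiplication by a + b turns b - a into (t - u)(t + u)/4, so the two bounds reduce to t - u >= 0
   times a + b plus or minus (t + u)/2, which is nonnegative. *)
have h1 : 0 <= (a + b) * (b - a + (t - u) / 2).
  have p1 : 0 <= (t - u) / 2 * ((t + u) / 2 + a + b) by apply: mulr_ge0; lra.
  lra.
have h2 : 0 <= (a + b) * (a - b + (t - u) / 2).
  have p2 : 0 <= (t - u) / 2 * (a + b - (t + u) / 2) by apply: mulr_ge0; lra.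
  lra.
by move: h1 h2; rewrite !pmulr_rge0// => ? ?; apply/andP; split; lra.
Qed.

Lemma phi_plus_mono (t u : R) : 0 <= (phi_plus s t - phi_plus s u) * (t - u).
Proof.
have [/phi_plus_incr/andP[? ?]|/ltW/phi_plus_incr/andP[? ?]] := leP u t.
  by apply: mulr_ge0; lra.
by rewrite -mulrNN; apply: mulr_ge0; lra.
Qed.

Lemma phi_plus_lip (t u : R) : `|phi_plus s t - phi_plus s u| <= `|t - u|.
Proof.
wlog ut : t u / u <= t => [hw|].
  by have [/hw//|/ltW/hw] := leP u t; rewrite distrC (distrC u).
have /andP[p0 pt] := phi_plus_incr ut.
by rewrite !ger0_norm// subr_ge0.
Qed.

Lemma phi_plus_continuous : continuous (phi_plus s).
Proof.
move=> t; rewrite /phi_plus.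
apply: (@continuousD R R^o R (fun t => t / 2)).
  exact: (@continuousM R R idfun (cst _) t (fun=> id) (@cst_continuous _ _ _
    _)).
have ct : {for t, continuous (fun t : R => t ^+ 2 / 4 + s)}.
  apply: (@continuousD R R^o R (fun t => t ^+ 2 / 4) (cst s)); last first.
    exact: cst_continuous.
  apply: (@continuousM R R (fun t => t ^+ 2) (cst _));
    last exact: cst_continuous.
  exact: exprn_continuous.
exact: (continuous_comp ct (@sqrt_continuous R _)).
Qed.

End phi_plus_theory.

(** * Inner products of vector fields *)

Section vector_L2.
Context {R : realType} {d : nat}.
Local Notation E := 'rV[R]_d.
Variables (mu : {measure set E -> \bar R}) (D : set E).
Hypothesis mD : measurable D.

Definition L2_field (F : E -> E) := forall i, L2 mu D (fun x => F x 0 i).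

Lemma L2_vinnerE F G : L2_field F -> L2_field G ->
  L2_vinner mu D F G = \sum_i L2_inner mu D (fun x => F x 0 i) (fun x =>
    G x 0 i).
Proof.
move=> LF LG; rewrite /L2_vinner /dot /L2_inner /Rintegral.
under eq_integral do rewrite -sumEFin.
have iFG i : mu.-integrable D (EFin \o (fun x => F x 0 i * G x 0 i)).
  exact: L2_mul_integrable.
rewrite (integral_sum mD iFG) -sum_fine// => i _.
exact: integrable_fin_num.
Qed.

Lemma L2_vinner_lin a b F G K : L2_field F -> L2_field G -> L2_field K ->
  L2_vinner mu D (fun x => a *: F x + b *: G x) K =
  a * L2_vinner mu D F K + b * L2_vinner mu D G K.
Proof.
move=> LF LG LK; rewrite !L2_vinnerE//; last first.
  by move=> i; rewrite lin_coord; exact: L2_lin.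
rewrite !mulr_sumr -big_split; apply: eq_bigr => i _.
by rewrite lin_coord L2_inner_lin.
Qed.

Lemma L2_vinnerC F G : L2_vinner mu D F G = L2_vinner mu D G F.
Proof.
apply: eq_Rintegral => x _; apply: eq_bigr => i _; exact: mulrC.
Qed.

Lemma L2_vsqnorm_ge0 F : 0 <= L2_vsqnorm mu D F.
Proof. by apply: Rintegral_ge0 => x _; exact: dot_ge0. Qed.

Lemma L2_sqnorm_ge0 f : 0 <= L2_sqnorm mu D f.
Proof. by apply: Rintegral_ge0 => x _; rewrite -expr2 sqr_ge0. Qed.

End vector_L2.

(** * Monotonicity and Lipschitz continuity of the discrete form *)

Section forms.
Context {R : realType} {d : nat}.
Local Notation E := 'rV[R]_d.
Variables (H : seq (E * R)) (Omega GammaD GammaC : set E) (k : nat).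
Variables (T : mesh R d) (f g : E -> R) (gamma s : R).
Hypothesis domain : polyhedral_lipschitz_domain H Omega.
Hypothesis decomp : boundary_decomposition Omega GammaD GammaC.
Hypothesis partition : is_partition Omega T.
Local Notation lambda := (lebesgue_rV R d).
Local Notation sigma := (surface_measure H).
Hypothesis Lf : L2 lambda Omega f.
Hypothesis Lg : L2 sigma GammaC g.
Hypothesis gamma_gt0 : 0 < gamma.
Hypothesis s_gt0 : 0 < s.
Local Notation V_h := (Vh H Omega GammaD k T).
Local Notation A := (form_A H Omega GammaC T g gamma s).
Local Notation sn := (sigma_n T GammaC).
Local Notation DP := (opDP T GammaC gamma).
Local Notation P := (opP T GammaC gamma g).
Let mO := measurable_domain domain.
Let nondeg := elt_nondegenerate partition.
Let pw v (Vv : V_h v) := Vh_piecewise_poly Vv.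

Lemma GammaC_sub_boundary : GammaC `<=` boundary Omega.
Proof. by have [U _ ->] := GammaC_open decomp => x []. Qed.

Lemma measurable_GammaC : measurable GammaC.
Proof.
have [U oU ->] := GammaC_open decomp; apply: measurableI.
  exact: measurable_boundary.
exact: open_measurable_rV.
Qed.
Let mG := measurable_GammaC.

Lemma surface_GammaC : (sigma GammaC < +oo)%E.
Proof.
apply: le_lt_trans (surface_boundary domain).
apply: le_measure; rewrite ?inE//; first exact: measurable_boundary.
exact: GammaC_sub_boundary.
Qed.

Lemma L2_Vh v : V_h v -> L2 lambda Omega v.
Proof. by move=> [[[]]]. Qed.

Lemma L2_gradh v : V_h v -> L2_field lambda Omega (gradh T v).
Proof. by move=> [[[]]]. Qed.

Lemma L2_Vh_GammaC v : V_h v -> L2 sigma GammaC v.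
Proof.
move=> [_ cv _]; apply: L2_within_continuous mG surface_GammaC _ _ cv.
  by move=> x /GammaC_sub_boundary/boundary_sub_closure.
exact: compact_closure_domain domain.
Qed.

Lemma L2_sigma_n v : L2 sigma GammaC (sn v).
Proof.
have [M snM] := sigma_n_bounded T GammaC v (compact_closure_domain domain).
apply: (@L2_bounded _ _ _ _ _ M mG surface_GammaC).
  by apply: measurable_funTS; exact: measurable_sigma_n.
by move=> x /GammaC_sub_boundary/boundary_sub_closure/snM.
Qed.

Lemma L2_DP v : V_h v -> L2 sigma GammaC (DP v).
Proof.
move=> Vv; have := L2_lin mG 1 (- gamma^-1) (L2_Vh_GammaC Vv) (L2_sigma_n v).
congr L2; apply/funext => x; rewrite /opDP; ring.
Qed.

Lemma L2_P v : V_h v -> L2 sigma GammaC (P v).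
Proof.
move=> Vv; have := L2_lin mG 1 (-1) (L2_DP Vv) Lg.
congr L2; apply/funext => x; rewrite /opP /opDP; ring.
Qed.

(** The 1-Lipschitz bound dominates the function by |P v| + |phi_plus s 0|, and the constant is
    square-integrable as the surface is finite. *)
Lemma L2_phi_P v : V_h v -> L2 sigma GammaC (fun x => phi_plus s (P v x)).
Proof.
move=> Vv; have LP := L2_P Vv; have [mP _] := LP.
have L0 := L2_cst mG (phi_plus s 0) surface_GammaC.
have mphi : measurable_fun GammaC (fun x =>
  phi_plus s (P v x) : measurableTypeR R).
  apply: (measurableT_comp (f := phi_plus s : measurableTypeR R ->
    measurableTypeR R)) mP.
  by apply: continuous_measurable_fun; exact: phi_plus_continuous.
apply: (L2_dominated mG mphi) (L2D mG (L2_norm mG LP) (L2_norm mG L0)) => x _.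
rewrite [leRHS]ger0_norm ?addr_ge0//.
have := phi_plus_lip s_gt0 (P v x) 0; rewrite subr0.
have := ler_normD (phi_plus s (P v x) - phi_plus s 0) (phi_plus s 0).
by rewrite subrK; lra.
Qed.

Lemma DP_lin a b v w : V_h v -> V_h w ->
  DP (fun x => a * v x + b * w x) = fun x => a * DP v x + b * DP w x.
Proof.
move=> Vv Vw; apply/funext => x.
by rewrite /opDP (sigma_n_lin nondeg)//; [ring|exact: pw..].
Qed.

(** The obstacle cancels, so monotonicity of [phi_plus] in P applies against the test function DP(v
    - w). *)
Lemma P_sub v w x : V_h v -> V_h w ->
  P v x - P w x = DP (fun y => v y - w y) x.
Proof.
move=> Vv Vw; have := congr1 (@^~ x) (DP_lin 1 (-1) Vv Vw).
rewrite /= (_ : (fun y => _) = fun y => v y - w y); last first.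
  by apply/funext => y; ring.
by move=> ->; rewrite /opP /opDP; ring.
Qed.

(** The symmetric bilinear part of [form_A]; coercivity is required of it alone. *)
Definition form_B v w :=
  form_a Omega T v w - gamma^-1 * L2_inner sigma GammaC (sn v) (sn w).

Lemma form_BC v w : form_B v w = form_B w v.
Proof. by rewrite /form_B /form_a L2_vinnerC L2_innerC. Qed.

Lemma form_B_lin a b v w z : V_h v -> V_h w -> V_h z ->
  form_B (fun x => a * v x + b * w x) z = a * form_B v z + b * form_B w z.
Proof.
move=> Vv Vw Vz; rewrite /form_B /form_a (gradh_lin nondeg); [|exact: pw..].
rewrite (sigma_n_lin nondeg); [|exact: pw..].
rewrite L2_vinner_lin//; [|exact: L2_gradh..].
rewrite L2_inner_lin//; [|exact: L2_sigma_n..].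
move: (L2_vinner _ _ (gradh T v) _) (L2_vinner _ _ (gradh T w) _) => x y.
move: (L2_inner _ _ (sn v) _) (L2_inner _ _ (sn w) _) => x' y'.
ring.
Qed.

Lemma form_AE v w : A v w = form_B v w +
  gamma * L2_inner sigma GammaC (fun x => phi_plus s (P v x)) (DP w).
Proof. by []. Qed.

Lemma form_A_lin u a b v w : V_h u -> V_h v -> V_h w ->
  A u (fun x => a * v x + b * w x) = a * A u v + b * A u w.
Proof.
move=> Vu Vv Vw; rewrite !form_AE form_BC form_B_lin// DP_lin//.
rewrite ![L2_inner sigma GammaC (fun x => phi_plus s _) _]L2_innerC.
rewrite L2_inner_lin//; [|exact: L2_DP..|exact: L2_phi_P].
rewrite (form_BC u v) (form_BC u w).
move: (form_B v u) (form_B w u) (L2_inner _ _ (DP v) _) (L2_inner _ _ (DP w) _).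
move=> x y x' y'; ring.
Qed.

Lemma form_l_lin a b v w : V_h v -> V_h w ->
  form_l Omega f (fun x => a * v x + b * w x) =
  a * form_l Omega f v + b * form_l Omega f w.
Proof.
move=> Vv Vw; rewrite /form_l ![L2_inner _ _ f _]L2_innerC.
by rewrite L2_inner_lin//; exact: L2_Vh.
Qed.

Lemma Vh_sub v w : V_h v -> V_h w -> V_h (fun x => v x - w x).
Proof.
move=> Vv Vw; have := Vh_lin domain partition 1 (-1) Vv Vw.
by congr Vh; apply/funext => x; ring.
Qed.

Lemma form_B_sub v w z : V_h v -> V_h w -> V_h z ->
  form_B (fun x => v x - w x) z = form_B v z - form_B w z.
Proof.
move=> Vv Vw Vz; have := form_B_lin 1 (-1) Vv Vw Vz.
rewrite (_ : (fun y => _) = fun y => v y - w y); last by apply/funext => y;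
  ring.
by move=> ->; rewrite mul1r mulN1r.
Qed.

Lemma form_A_sub v1 v2 w : V_h v1 -> V_h v2 -> V_h w ->
  A v1 w - A v2 w = form_B (fun x => v1 x - v2 x) w +
    gamma * L2_inner sigma GammaC
      (fun x => phi_plus s (P v1 x) - phi_plus s (P v2 x)) (DP w).
Proof.
move=> V1 V2 Vw; rewrite !form_AE form_B_sub//.
have := L2_inner_lin mG 1 (-1) (L2_phi_P V1) (L2_phi_P V2) (L2_DP Vw).
rewrite (_ : (fun y => _) = fun y => phi_plus s (P v1 y) - phi_plus s (P v2 y)).
  move=> ->; move: (L2_inner _ _ _ _) (L2_inner _ _ _ _) (form_B v1 w) => x y z.
  by move: (form_B v2 w) => z'; ring.
by apply/funext => y; ring.
Qed.

Lemma form_A_mono v1 v2 : V_h v1 -> V_h v2 ->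
  form_B (fun x => v1 x - v2 x) (fun x => v1 x - v2 x) <=
  A v1 (fun x => v1 x - v2 x) - A v2 (fun x => v1 x - v2 x).
Proof.
move=> V1 V2; rewrite form_A_sub//; last exact: Vh_sub.
rewrite lerDl mulr_ge0 ?(ltW gamma_gt0)//; apply: L2_inner_ge0 => x _.
by rewrite -P_sub//; exact: phi_plus_mono.
Qed.

(** A majorant for the variation of [form_A] in its first argument. The absolute values inside the
    integral make it subadditive and absolutely homogeneous there. *)
Definition form_M v w := `|form_B v w| +
  gamma * L2_inner sigma GammaC (fun x => `|DP v x|) (fun x => `|DP w x|).

Lemma form_A_lip v1 v2 w : V_h v1 -> V_h v2 -> V_h w ->
  `|A v1 w - A v2 w| <= form_M (fun x => v1 x - v2 x) w.
Proof.
move=> V1 V2 Vw; rewrite form_A_sub// /form_M.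
rewrite (le_trans (ler_normD _ _))// lerD2l normrM gtr0_norm// ler_pM2l//.
have Lphi := L2B mG (L2_phi_P V1) (L2_phi_P V2).
have LDP := L2_DP (Vh_sub V1 V2); have LDPw := L2_DP Vw.
rewrite (le_trans (normr_L2_inner mG Lphi LDPw))//.
apply: le_L2_inner => //; [exact: L2_norm..|] => x _.
by rewrite ler_wpM2r// -P_sub//; exact: phi_plus_lip.
Qed.

Lemma form_M_lin a b v w z : V_h v -> V_h w -> V_h z ->
  form_M (fun x => a * v x + b * w x) z <= `|a| * form_M v z + `|b| * form_M w
    z.
Proof.
move=> Vv Vw Vz; rewrite /form_M form_B_lin// DP_lin//.
have LDv := L2_norm mG (L2_DP Vv); have LDw := L2_norm mG (L2_DP Vw).
have LDz := L2_norm mG (L2_DP Vz).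
have b1 (x y : R) : `|a * x + b * y| <= `|a| * `|x| + `|b| * `|y|.
  by rewrite -!normrM ler_normD.
have : L2_inner sigma GammaC (fun x => `|a * DP v x + b * DP w x|)
      (fun x => `|DP z x|) <=
    `|a| * L2_inner sigma GammaC (fun x => `|DP v x|) (fun x => `|DP z x|) +
    `|b| * L2_inner sigma GammaC (fun x => `|DP w x|) (fun x => `|DP z x|).
  rewrite -L2_inner_lin//; apply: le_L2_inner => //.
  - apply: L2_norm => //; apply: L2_lin => //; exact: L2_DP.
  - exact: L2_lin.
  by move=> x _; rewrite ler_wpM2r.
move: (form_B v z) (form_B w z) => x y; move/(_ x y) in b1.
move: (L2_inner _ _ (fun x => `|DP v x|) _) (L2_inner _ _ (fun x =>
  `|DP w x|) _).
move=> p q; move: (L2_inner _ _ _ _) => r; rewrite -(ler_pM2l gamma_gt0); lra.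
Qed.

End forms.

(** * Continuous functions with vanishing L2 norm *)

Section definiteness.
Context {R : realType} {d : nat}.
Local Notation E := 'rV[R]_d.
Local Notation lambda := (lebesgue_rV R d).

(** A nonzero value inside Omega would persist on a nonempty open set, which has positive measure,
    while v vanishes almost everywhere. *)
Lemma L2_sqnorm_eq0 (Omega : set E) (v : E -> R) : open Omega ->
  {within closure Omega, continuous v} -> L2 lambda Omega v ->
  L2_sqnorm lambda Omega v = 0 -> forall x, closure Omega x -> v x = 0.
Proof.
move=> oO cv Lv v0; have mO := open_measurable_rV oO.
have cvO : {in Omega, continuous v}.
  rewrite -continuous_open_subspace//.
  by apply: continuous_subspaceW cv; exact: subset_closure.
have zero_in x : Omega x -> v x = 0.
  move=> Ox; apply/eqP; apply: contraT => vx0.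
  pose W := Omega `&` [set y | v y != 0].
  have oW : open W.
    rewrite openE => y [Oy vy0]; apply: filterI; first exact: open_nbhs_nbhs.
    exact: (cvO y (mem_set Oy) _ (open_nbhs_nbhs (conj (@open_neq _ 0) vy0))).
  have : (0 < lambda W)%E by apply: open_lebesgue_rV_gt0 => //; exists x.
  have /integrableP[mv _] := L2_sqr_integrable Lv.
  have : (\int[lambda]_(x in Omega) `|(v x ^+ 2)%:E|)%E = 0.
    rewrite -[LHS]fineK; last first.
      have := integrable_fin_num mO (integrable_abse (L2_sqr_integrable Lv)).
      exact.
    rewrite [fine _](_ : _ = L2_sqnorm lambda Omega v); first by rewrite v0.
    rewrite /L2_sqnorm /L2_inner /Rintegral; congr (fine _).
    by apply: eq_integral => y _; rewrite /= ger0_norm ?sqr_ge0.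
  move=> /(ae_eq_integral_abs _ mO mv)[N [mN N0 sub]].
  rewrite ltNge => /negP[]; rewrite -N0; apply: le_measure; rewrite ?inE//.
    exact: open_measurable_rV.
  move=> y [Oy vy0]; apply: sub => /= /(_ Oy)[] /eqP.
  by rewrite expf_eq0/=; apply/negP.
(* At a point of the closure, a nonzero value would persist at nearby points of Omega, by continuity
   within the closure. *)
move=> x Cx; apply/eqP; apply: contraT => vx0.
have /subspace_continuousP/(_ x Cx) := cv.
move=> /(_ _ (open_nbhs_nbhs (conj (@open_neq _ 0) vx0))) nx.
have [y [Oy]] := Cx _ nx.
move=> /(_ (subset_closure Oy)) Wy; have /eqP[] : v y != 0 by exact: Wy.
exact: zero_in.
Qed.

End definiteness.

(** * Coordinates on V_h *)

Section coefficients.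
Context {R : realType} {d : nat}.
Local Notation E := 'rV[R]_d.
Variables (H : seq (E * R)) (Omega GammaD GammaC : set E) (k : nat).
Variable T : mesh R d.
Hypothesis partition : is_partition Omega T.
Local Notation V_h := (Vh H Omega GammaD k T).
Let nondeg := elt_nondegenerate partition.
Local Notation I := ('I_(nelt T) * mpoly.bmultinom d k.+1)%type.

(** [bmultinom d k.+1] holds the exponents of degree strictly below k + 1, which matches the bound
    on [msize] in [Vh]. *)
Definition coefs (v : E -> R) : 'rV[R]_#|{: I}| :=
  \row_j mpoly.mcoeff (mpoly.bmnm (enum_val j).2) (local_poly v (enum_val j).1).

Lemma coefs_lin a b v w : V_h v -> V_h w ->
  coefs (fun x => a * v x + b * w x) = a *: coefs v + b *: coefs w.
Proof.
move=> Vv Vw; apply/rowP => j; rewrite !mxE local_poly_lin//.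
- by rewrite mpoly.mcoeffD !mpoly.mcoeffZ.
- exact: Vh_piecewise_poly Vv.
- exact: Vh_piecewise_poly Vw.
Qed.

Lemma simplex_sub_closure i : simplex (elt T i) `<=` closure Omega.
Proof. by rewrite (elt_cover partition) => x ix; exists i. Qed.

Lemma local_poly_eq0 v : (forall x, closure Omega x -> v x = 0) ->
  forall i : 'I_(nelt T), local_poly v i = 0.
Proof.
move=> v0 i; apply: (local_polyE nondeg) => x /simplex_sub_closure/v0 ->.
by rewrite /poly_eval mpoly.meval0.
Qed.

Lemma coefs_eq0 v : V_h v ->
  coefs v = 0 <-> (forall x, closure Omega x -> v x = 0).
Proof.
move=> Vv; split=> [v0 x|/local_poly_eq0 v0]; last first.
  by apply/rowP => j; rewrite !mxE v0 mpoly.mcoeff0.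
have [_ _ pv] := Vv.
rewrite (elt_cover partition) => -[i _ ix].
have [p sp vp] := pv i; rewrite vp//.
suff -> : p = 0 by rewrite /poly_eval mpoly.meval0.
apply/mpoly.mpolyP => m; rewrite mpoly.mcoeff0.
(* Exponents of degree above k do not occur in p; all others are recorded in [coefs]. *)
have [mk|] := ltnP (mpoly.mdeg m) k.+1; last first.
  move=> km; apply/eqP; rewrite mpoly.mcoeff_eq0.
  by apply: mpoly.msize_mdeg_ge; exact: leq_trans km.
have := congr1 (fun y : 'rV_#|{: I}| =>
  y 0 (enum_rank (i, mpoly.BMultinom mk))) v0.
by rewrite !mxE enum_rankK /= (local_polyE nondeg vp).
Qed.

Lemma gradh_eq0 v : (forall x, closure Omega x -> v x = 0) ->
  gradh T v = fun=> 0.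
Proof.
move=> /local_poly_eq0 v0; apply/funext => x; rewrite /gradh;
  case: pickP => // i _.
by rewrite v0; apply/rowP => j;
  rewrite !mxE mpoly.mderiv0 /poly_eval mpoly.meval0.
Qed.

Lemma sigma_n_eq0 v : (forall x, closure Omega x -> v x = 0) ->
  sigma_n T GammaC v = fun=> 0.
Proof.
move=> /local_poly_eq0 v0; apply/funext => x; rewrite /sigma_n;
  case: pickP => // i _.
rewrite v0 /dot big1// => j _.
by rewrite mxE mpoly.mderiv0 /poly_eval mpoly.meval0 mul0r.
Qed.

End coefficients.

(** * The H^1 inner product on V_h *)

Section H1_form.
Context {R : realType} {d : nat}.
Local Notation E := 'rV[R]_d.
Variables (H : seq (E * R)) (Omega GammaD : set E) (k : nat) (T : mesh R d).
Hypothesis domain : polyhedral_lipschitz_domain H Omega.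
Hypothesis partition : is_partition Omega T.
Local Notation V_h := (Vh H Omega GammaD k T).
Local Notation lambda := (lebesgue_rV R d).
Let mO := measurable_domain domain.
Let nondeg := elt_nondegenerate partition.

(** The polarisation of [H1_sqnorm] at the discrete gradient, needed because the abstract problem
    expands its quadratic form over a basis. *)
Definition H1_inner v w := L2_inner lambda Omega v w +
  L2_vinner lambda Omega (gradh T v) (gradh T w).

Lemma H1_innerC v w : H1_inner v w = H1_inner w v.
Proof. by rewrite /H1_inner L2_innerC L2_vinnerC. Qed.

Lemma H1_inner_lin a b v w z : V_h v -> V_h w -> V_h z ->
  H1_inner (fun x => a * v x + b * w x) z = a * H1_inner v z + b * H1_inner w z.
Proof.
move=> Vv Vw Vz; rewrite /H1_inner (gradh_lin nondeg);
  [|exact: Vh_piecewise_poly Vv|exact: Vh_piecewise_poly Vw].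
rewrite L2_vinner_lin//; [|exact: L2_gradh Vv|exact: L2_gradh Vw|exact:
  L2_gradh Vz].
rewrite L2_inner_lin//; [|exact: L2_Vh Vv|exact: L2_Vh Vw|exact: L2_Vh Vz].
by rewrite !mulrDr addrACA.
Qed.

Lemma H1_inner_ge0 v : 0 <= H1_inner v v.
Proof. by apply: addr_ge0; [exact: L2_sqnorm_ge0|exact: L2_vsqnorm_ge0]. Qed.

Lemma H1_inner_eq0 v : V_h v -> H1_inner v v = 0 ->
  forall x, closure Omega x -> v x = 0.
Proof.
move=> Vv v0; have [_ cv _] := Vv.
apply: (L2_sqnorm_eq0 (domain_open domain) cv (L2_Vh Vv)).
move: v0 (L2_sqnorm_ge0 lambda Omega v) (L2_vsqnorm_ge0 lambda Omega (gradh T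
  v)).
rewrite /H1_inner /L2_vsqnorm /L2_sqnorm.
move: (L2_inner _ _ _ _) (L2_vinner _ _ _ _) => a b; lra.
Qed.

End H1_form.

(** * Well-posedness from coercivity of the bilinear part *)

Section discrete_problem.
Context {R : realType} {d : nat}.
Local Notation E := 'rV[R]_d.
Variables (H : seq (E * R)) (Omega GammaD GammaC : set E) (k : nat).
Variables (T : mesh R d) (f g : E -> R) (gamma s kappa : R).
Hypothesis domain : polyhedral_lipschitz_domain H Omega.
Hypothesis decomp : boundary_decomposition Omega GammaD GammaC.
Hypothesis partition : is_partition Omega T.
Local Notation lambda := (lebesgue_rV R d).
Local Notation sigma := (surface_measure H).
Hypothesis Lf : L2 lambda Omega f.
Hypothesis Lg : L2 sigma GammaC g.
Hypothesis gamma_gt0 : 0 < gamma.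
Hypothesis s_gt0 : 0 < s.
Hypothesis kappa_gt0 : 0 < kappa.
Local Notation V_h := (Vh H Omega GammaD k T).
Local Notation A := (form_A H Omega GammaC T g gamma s).
Local Notation l := (form_l Omega f).
Hypothesis coercive : forall v, V_h v ->
  kappa * H1_inner Omega T v v <= form_B H Omega GammaC T gamma v v.

Lemma form_A_strongly_mono v1 v2 : V_h v1 -> V_h v2 ->
  kappa * H1_inner Omega T (fun x => v1 x - v2 x) (fun x => v1 x - v2 x) <=
  A v1 (fun x => v1 x - v2 x) - A v2 (fun x => v1 x - v2 x).
Proof.
move=> V1 V2; apply: le_trans (coercive (Vh_sub domain partition V1 V2)) _.
exact: (form_A_mono domain decomp partition Lg gamma_gt0 s_gt0 V1 V2).
Qed.

(** Testing both equations with u' - u annihilates the upper bound in strong monotonicity, so the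
    H^1 norm of the difference is zero. *)
Lemma discrete_problem_unique u u' : V_h u -> V_h u' ->
  (forall v, V_h v -> A u v = l v) -> (forall v, V_h v -> A u' v = l v) ->
  forall x, closure Omega x -> u' x = u x.
Proof.
move=> Vu Vu' uA u'A x Cx; apply/eqP; rewrite -subr_eq0; apply/eqP.
have Vw := Vh_sub domain partition Vu' Vu.
apply: (H1_inner_eq0 domain Vw _ Cx).
have := form_A_strongly_mono Vu' Vu;
  rewrite uA// u'A// subrr pmulr_rle0// => w0.
by apply/eqP; rewrite eq_le w0 H1_inner_ge0.
Qed.

Lemma form_eq0 v : V_h v -> (forall x, closure Omega x -> v x = 0) ->
  l v = 0 /\ forall u, V_h u -> A u v = 0.
Proof.
move=> Vv v0; have L0 (mu : {measure set E -> \bar R}) D h : L2_inner mu D h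
  (fun=> 0) = 0.
  by rewrite /L2_inner; under eq_Rintegral do rewrite mulr0;
    rewrite /Rintegral integral0.
split.
  rewrite /form_l -[RHS](L0 lambda Omega f); apply: eq_L2_inner => // x.
  by rewrite inE => /subset_closure/v0.
move=> u Vu; rewrite /form_A /form_a (gradh_eq0 partition v0).
rewrite (sigma_n_eq0 GammaC partition v0) L0 mulr0 subr0.
rewrite (_ : L2_vinner _ _ _ _ = 0) ?add0r; last first.
  have dot0 x : dot x (0 : E) = 0.
    by rewrite /dot big1// => i _; rewrite mxE mulr0.
  rewrite /L2_vinner; under eq_Rintegral do rewrite dot0.
  by rewrite /Rintegral integral0.
apply/eqP; rewrite mulf_eq0; apply/orP; right; apply/eqP.
rewrite -[RHS](L0 sigma GammaC (fun x =>
  phi_plus s (opP T GammaC gamma g u x))).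
apply: eq_L2_inner => // x; rewrite inE => /(GammaC_sub_boundary decomp).
move=> /boundary_sub_closure/v0 vx.
by rewrite /opDP (sigma_n_eq0 GammaC partition v0) vx mul0r subr0.
Qed.

Lemma discrete_problem_solvable :
  exists2 u, V_h u & forall v, V_h v -> A u v = l v.
Proof.
(* In this module the operations are pointwise, so abstract combinations are convertible to the
   functions [fun x => a * v x + b * w x] used above. *)
pose X : lmodType R := E -> R^o.
apply: (@monotone_problem_solvable R X _ V_h (@coefs R d k T) A l
  (H1_inner Omega T) (form_M H Omega GammaC T gamma) kappa).
- split; first exact: Vh0.
  by move=> a b u v; exact: Vh_lin.
- by move=> a b u v Vu Vv; exact: (coefs_lin partition a b Vu Vv).
- by move=> u Vu a b v w Vv Vw;
  exact: (form_A_lin _ domain decomp partition Lg s_gt0 a b Vu Vv Vw).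
- by move=> a b v w Vv Vw; exact: (form_l_lin domain Lf a b Vv Vw).
- by move=> v Vv a b u w Vu Vw;
  exact: (H1_inner_lin domain partition a b Vu Vw Vv).
- move=> u Vu a b v w Vv Vw; rewrite /= !(H1_innerC _ _ u);
  exact: (H1_inner_lin domain partition a b Vv Vw Vu).
- by move=> u Vu; exact: H1_inner_ge0.
- by move=> u Vu u0; apply/(coefs_eq0 partition Vu);
  exact: (H1_inner_eq0 domain Vu u0).
- exact: kappa_gt0.
- by move=> u v Vu Vv; exact: (form_A_strongly_mono Vu Vv).
- by move=> a b u v w Vu Vv Vw;
  exact: (form_M_lin domain decomp partition gamma_gt0 a b Vu Vv Vw).
- by move=> u v w Vu Vv Vw; exact: (form_A_lip domain decomp partition Lg
  gamma_gt0 s_gt0 Vu Vv Vw).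
- by move=> v Vv /(coefs_eq0 partition Vv); exact: form_eq0.
Qed.

End discrete_problem.

Theorem proposition4p1 (R : realType) (d k : nat) (hd : d = 2%N \/ d = 3%N)
  (H : seq ('rV[R]_d * R)) (Omega GammaD GammaC : set 'rV[R]_d)
  (hOmega : polyhedral_lipschitz_domain H Omega)
  (hGamma : boundary_decomposition Omega GammaD GammaC)
  (hD : (0 < surface_measure H GammaD)%E)
  (cP : R) (hcP : 0 < cP)
  (hpoincare : forall w G, in_V H Omega GammaD w G ->
     cP * H1_sqnorm Omega w G <= L2_vinner (lebesgue_rV R d) Omega G G)
  (f : 'rV[R]_d -> R) (hf : L2 (lebesgue_rV R d) Omega f)
  (g : 'rV[R]_d -> R) (hg : H_half H GammaC g)
  (h0 : R) (hh0 : 0 < h0) (T : R -> mesh R d)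
  (hpartition : forall h : R, 0 < h <= h0 -> is_partition Omega (T h))
  (hfitted : forall h : R, 0 < h <= h0 ->
     boundary_fitted GammaD (T h) /\ boundary_fitted GammaC (T h))
  (hregular : exists2 kappa : R, 0 < kappa &
     forall h : R, 0 < h <= h0 -> shape_regular kappa (T h))
  (hquasi : exists2 q : R, 0 < q &
     forall h : R, 0 < h <= h0 -> quasiuniform q h (T h))
  (CI : R) (hCI : 0 <= CI)
  (hinverse : forall h : R, 0 < h <= h0 -> forall w,
     Vh H Omega GammaD k (T h) w ->
     L2_sqnorm (surface_measure H) GammaC (sigma_n (T h) GammaC w) <=
     CI * h^-1 * L2_vsqnorm (lebesgue_rV R d) Omega (gradh (T h) w))
  (gamma0 : R) (hgamma0 : CI < gamma0) :
  let C := 1 - CI / gamma0 in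
  0 < C /\
  forall h : R, 0 < h <= h0 -> forall s : R, 0 < s ->
    let gamma := gamma0 / h in
    let A := form_A H Omega GammaC (T h) g gamma s in
    let V_h := Vh H Omega GammaD k (T h) in
    (forall v1 v2, V_h v1 -> V_h v2 ->
       cP * C * H1_sqnorm Omega (fun x => v1 x - v2 x)
                                (gradh (T h) (fun x => v1 x - v2 x))
       <= A v1 (fun x => v1 x - v2 x) - A v2 (fun x => v1 x - v2 x)) /\
    (exists2 u, V_h u /\ (forall v, V_h v -> A u v = form_l Omega f v) &
       forall u', V_h u' -> (forall v, V_h v -> A u' v = form_l Omega f v) ->
         forall x, closure Omega x -> u' x = u x).
Proof.
move=> C.
have gamma0_gt0 : 0 < gamma0 by exact: le_lt_trans hgamma0.
have C_gt0 : 0 < C by rewrite subr_gt0 ltr_pdivrMr// mul1r.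
split=> // h hh s s_gt0 gamma A V_h; have [h_gt0 _] := andP hh.
have gamma_gt0 : 0 < gamma by rewrite divr_gt0.
have kappa_gt0 : 0 < cP * C by rewrite mulr_gt0.
have [Lg _] := hg.
(* Here a(v, v) - |sigma_n(v)|^2 / gamma >= C a(v, v) >= cP C |v|^2, the last norm being that of
   H^1. *)
have coercive v : V_h v -> cP * C * H1_inner Omega (T h) v v <=
    form_B H Omega GammaC (T h) gamma v v.
  move=> Vv; have [iv _ _] := Vv.
  have := hinverse h hh v Vv; have := hpoincare _ _ iv.
  rewrite /form_B /form_a /L2_vsqnorm /L2_sqnorm /H1_inner /H1_sqnorm.
  rewrite /L2_vsqnorm /L2_sqnorm /gamma.
  move: (L2_inner _ _ _ _) (L2_inner _ _ _ _) (L2_vinner _ _ _ _) => sn2 v2 a.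
  move=> va sna.
  have C_va : cP * C * (v2 + a) <= C * a by rewrite mulrAC mulrC ler_wpM2l//
    ltW.
  (* The factor h in 1/gamma cancels the 1/h of the inverse inequality, so the constant does not
     depend on the mesh. *)
  have gsn : (gamma0 / h)^-1 * sn2 <= CI / gamma0 * a.
    rewrite (_ : CI / gamma0 * a = (gamma0 / h)^-1 * (CI / h * a)); last first.
      by field; rewrite !gt_eqF.
    by rewrite ler_wpM2l// invr_ge0 ltW.
  by apply: le_trans C_va _; rewrite mulrBl mul1r lerD2l lerN2.
split=> [v1 v2 V1 V2|].
  exact: (form_A_strongly_mono hOmega hGamma (hpartition h hh) Lg gamma_gt0
    s_gt0
    coercive V1 V2).
have [u Vu uA] := discrete_problem_solvable hOmega hGamma (hpartition h hh)
  hf Lg gamma_gt0 s_gt0 kappa_gt0 coercive.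
exists u => // u' Vu' u'A.
exact: (discrete_problem_unique hOmega hGamma (hpartition h hh) Lg gamma_gt0
  s_gt0 kappa_gt0 coercive Vu Vu' uA u'A).
Qed.
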